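(* Let $\mathcal R=(R,<,+,0,\ldots)$ be a definably complete expansion of a densely linearly ordered abelian group. \begin{itemize} \item If $\mathcal R$ satisfies strongly locally uniform finiteness ($\mathrm{SLUF}$), then the open core of $\mathcal R$ is strongly locally o-minimal. \item If $\mathcal R$ satisfies locally uniform finiteness of the first kind ($\mathrm{LUF}_1$), then the open core of $\mathcal R$ is uniformly locally o-minimal of the first kind. \item If $\mathcal R$ satisfies locally uniform finiteness of the second kind ($\mathrm{LUF}_2$), then the open core of $\mathcal R$ is uniformly locally o-minimal of the second kind. \end{itemize}
   Context: Conventions: ''definable'' means definable in the given structure with parameters. $R$ carries the order topology and $R^n$ the product topology ($R^0$ is a one-point space). An open interval is a set $(c,d)=\{x: c<x<d\}$ and a closed interval a set $[c,d]=\{x:c\le x\le d\}$ with $c,d\in R$; an open (closed) box in $R^n$ is a product of $n$ open (closed) intervals. $\mathrm{int}(A)$ is the interior of $A$. For $X\subset R^{m+n}$ and $x\in R^m$, $X_x=\{y\in R^n: (x,y)\in X\}$. $|S|$ is the cardinality of $S$ ($|S|=\infty$ means $S$ infinite). An expansion of a densely linearly ordered abelian group is a structure $\mathcal R=(R,<,+,0,\ldots)$ where $(R,+,0)$ is an abelian group and $<$ is a dense translation-invariant linear order. Definably complete: every definable subset of $R$ has a supremum and an infimum in $R\cup\{\pm\infty\}$. $\mathrm{LUF}_2$: for all $m$, every definable $X\subset R^{m+1}$, $a\in R$, $b\in R^m$, there exist a positive integer $N$, a closed interval $I$ with $a\in\mathrm{int}(I)$ and an open box $U\subset R^m$ with $b\in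 U$ such that $|X_x\cap J|=\infty$ or $|X_x\cap J|\le N$ for all $x\in U$ and all closed intervals $J$ with $a\in\mathrm{int}(J)\subset I$. $\mathrm{LUF}_1$: $\mathrm{LUF}_2$ holds and one can always take $U=R^m$. $\mathrm{SLUF}$: $\mathrm{LUF}_1$ holds and moreover $I$ can be taken independently of the definable set $X$ (i.e. for every $a\in R$ there is a closed interval $I$ with $a\in \mathrm{int}(I)$ such that for every $m$ and every definable $X\subset R^{m+1}$ there is a positive integer $N$ with $|X_x\cap J|=\infty$ or $|X_x\cap J|\le N$ for all $x\in R^m$ and all closed intervals $J$ with $a\in\mathrm{int}(J)\subset I$). The open core of $\mathcal R$ is the structure with universe $R$ whose primitive relations are all open subsets of $R^n$, $n\ge1$, definable in $\mathcal R$ (it includes the order $<$). A densely linearly ordered structure $\mathcal M=(M,<,\ldots)$ is: strongly locally o-minimal if for every $a\in M$ there is an open interval $I\ni a$ such that for every definable $X\subset M$ the set $X\cap I$ is a finite union of points and open intervals; uniformly locally o-minimal of the second kind if for every positive integer $n$, every definable $X\subset M^{n+1}$, $a\in M$ and $b\in M^n$, there exist an open interval $I\ni a$ and an open box $B\ni b$ in $M^n$ such that $X_y\cap I$ is a finite union of points and open intervals for all $y\in B$; uniformly locally o-minimal of the first kind if in the latter one can always take $B=M^n$. *)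

(* Defs.v *)
From mathcomp Require Import all_boot all_order all_algebra.
From mathcomp Require Import all_classical.
From mathcomp Require Import constructive_ereal topology.
Set Implicit Arguments.
Unset Strict Implicit.
Unset Printing Implicit Defensive.
Import Order.TTheory GRing.Theory.
Local Open Scope classical_set_scope.
Local Open Scope ring_scope.

(* Cartesian powers T^n are the row vectors 'rV[T]_n; for a topological T they
   carry the product topology. *)

Record language := Language {
  rel_sym : nat -> Type; (* n-ary relation symbols *)
  fun_sym : nat -> Type  (* n-ary function symbols, constants being n = 0 *)
}.

Record structure (L : language) (T : Type) := Structure {
  rel_interp : forall n, rel_sym L n -> set 'rV[T]_n;
  fun_interp : forall n, fun_sym L n -> 'rV[T]_n -> T
}.

Inductive term (L : language) : Type :=
| TVar of nat
| TApp n of fun_sym L n & ('I_n -> term L).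

Arguments TVar {L}.

(* De Bruijn indices: [FEx] binds variable 0. *)
Inductive formula (L : language) : Type :=
| FEq of term L & term L
| FRel n of rel_sym L n & ('I_n -> term L)
| FNot of formula L
| FAnd of formula L & formula L
| FEx of formula L.

Section Definability.
Context {L : language} {T : Type} (S : structure L T).

Fixpoint eval (e : nat -> T) (t : term L) : T :=
  match t with
  | TVar i => e i
  | TApp n f ts => fun_interp S f (\row_i eval e (ts i))
  end.

Definition push (x : T) (e : nat -> T) (i : nat) : T :=
  if i is j.+1 then e j else x.

Fixpoint sat (e : nat -> T) (phi : formula L) : Prop :=
  match phi with
  | FEq t u => eval e t = eval e u
  | FRel n r ts => rel_interp S r (\row_i eval e (ts i))
  | FNot psi => ~ sat e psi
  | FAnd psi chi => sat e psi /\ sat e chi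
  | FEx psi => exists x, sat (push x e) psi
  end.

(* Variables 0, ..., n - 1 stand for the coordinates of v; the remaining ones
   are assigned the parameters e 0, e 1, ... *)
Definition assign n (v : 'rV[T]_n) (e : nat -> T) (i : nat) : T :=
  if insub i is Some j then v 0 j else e (i - n)%N.

Definition definable n (X : set 'rV[T]_n) : Prop :=
  exists (phi : formula L) (e : nat -> T), X = [set v | sat (assign v e) phi].

Definition definable1 (X : set T) : Prop :=
  definable [set v : 'rV[T]_1 | X (v 0 0)].

End Definability.

Definition slice (T : Type) m (X : set 'rV[T]_(m + 1)) (x : 'rV[T]_m) : set T :=
  [set y | X (row_mx x (const_mx y))].

Record densely_ordered_group (d : Order.disp_t) (T : orderType d)
    (add : T -> T -> T) (zero : T) : Prop := DenselyOrderedGroup {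
  dog_addA : associative add;
  dog_addC : commutative add;
  dog_add0 : left_id zero add;
  dog_addN : exists opp : T -> T, left_inverse zero opp add;
  dog_translate : forall z x y : T, (x < y)%O -> (add x z < add y z)%O;
  dog_dense : forall x y : T, (x < y)%O -> exists z, (x < z < y)%O;
  (* A dense order has more than one point; without this, the trivial group
     {0}, which has no nonempty open interval (a, b), would be allowed. *)
  dog_nontrivial : exists x : T, x != zero
}.

Definition expands_ordered_group (L : language) (d : Order.disp_t)
    (T : orderType d) (add : T -> T -> T) (zero : T) (S : structure L T) :
    Prop :=
  [/\ exists r : rel_sym L 2,
        forall v, rel_interp S r v <-> (v 0 0 < v 0 1)%O,
      exists f : fun_sym L 2,
        forall v, fun_interp S f v = add (v 0 0) (v 0 1) &
      exists c : fun_sym L 0, forall v, fun_interp S c v = zero].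

Section OrderedStructures.
Local Open Scope order_scope.
Context {d : Order.disp_t} {T : orderType d}.

(* The order of T with two endpoints adjoined. (The library orders \bar T only
   for T a numDomainType; here \bar T is used as a bare type.) *)
Definition ext_le (x y : \bar T) : Prop :=
  match x, y with
  | -oo%E, _ | _, +oo%E => True
  | EFin a, EFin b => a <= b
  | _, _ => False
  end.

Definition is_ext_sup (X : set T) (s : \bar T) : Prop :=
  (forall x, X x -> ext_le (EFin x) s) /\
  (forall t, (forall x, X x -> ext_le (EFin x) t) -> ext_le s t).

Definition is_ext_inf (X : set T) (s : \bar T) : Prop :=
  (forall x, X x -> ext_le s (EFin x)) /\
  (forall t, (forall x, X x -> ext_le t (EFin x)) -> ext_le t s).

Definition definably_complete (L : language) (S : structure L T) : Prop :=
  forall X : set T, definable1 S X ->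
    (exists s, is_ext_sup X s) /\ (exists s, is_ext_inf X s).

Definition open_interval (I : set T) : Prop :=
  exists a b : T, I = `]a, b[%classic.

Definition closed_interval (I : set T) : Prop :=
  exists a b : T, I = `[a, b]%classic.

Definition open_box n (B : set 'rV[T]_n) : Prop :=
  exists a b : 'rV[T]_n, B = [set v | forall i, a 0%R i < v 0%R i < b 0%R i].

Definition finite_union_points_intervals (Y : set T) : Prop :=
  exists (s : seq T) (l : seq (T * T)),
    Y = [set` s] `|` \bigcup_(p in [set` l]) `]p.1, p.2[%classic.

Definition strongly_locally_o_minimal (L : language) (S : structure L T) :
    Prop :=
  forall a : T, exists I, [/\ open_interval I, I a &
    forall X : set T, definable1 S X ->
      finite_union_points_intervals (X `&` I)].

Definition uniformly_locally_o_minimal_2 (L : language) (S : structure L T) :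
    Prop :=
  forall n, (0 < n)%N -> forall X : set 'rV[T]_(n + 1), definable S X ->
  forall (a : T) (b : 'rV[T]_n), exists I B,
    [/\ open_interval I, I a, open_box B, B b &
        forall y, B y -> finite_union_points_intervals (slice X y `&` I)].

Definition uniformly_locally_o_minimal_1 (L : language) (S : structure L T) :
    Prop :=
  forall n, (0 < n)%N -> forall X : set 'rV[T]_(n + 1), definable S X ->
  forall a : T, exists I, [/\ open_interval I, I a &
    forall y, finite_union_points_intervals (slice X y `&` I)].

End OrderedStructures.

Section LocallyUniformFiniteness.
Context {d : Order.disp_t} {T : orderTopologicalType d}.
Context {L : language} (S : structure L T).

Definition uniformly_finite_near m (X : set 'rV[T]_(m + 1)) (a : T)
    (I : set T) (U : set 'rV[T]_m) : Prop :=
  exists2 N : nat, (0 < N)%N &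
    forall x, U x -> forall J, closed_interval J -> J° a -> J° `<=` I ->
      infinite_set (slice X x `&` J) \/ (slice X x `&` J #<= `I_N)%card.

Definition LUF2 : Prop :=
  forall m (X : set 'rV[T]_(m + 1)), definable S X ->
  forall (a : T) (b : 'rV[T]_m), exists I U,
    [/\ closed_interval I, I° a, open_box U, U b &
        uniformly_finite_near X a I U].

Definition LUF1 : Prop :=
  LUF2 /\
  forall m (X : set 'rV[T]_(m + 1)), definable S X ->
  forall a : T, exists I,
    [/\ closed_interval I, I° a & uniformly_finite_near X a I setT].

Definition SLUF : Prop :=
  LUF1 /\
  forall a : T, exists I, [/\ closed_interval I, I° a &
    forall m (X : set 'rV[T]_(m + 1)), definable S X ->
      uniformly_finite_near X a I setT].

End LocallyUniformFiniteness.

Section OpenCore.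
Context {L : language} {T : topologicalType} (S : structure L T).

Definition open_core_language : language :=
  {| rel_sym n := {U : set 'rV[T]_n | [/\ (0 < n)%N, open U & definable S U]};
     fun_sym _ := void |}.

Definition open_core : structure open_core_language T :=
  @Structure open_core_language T
    (fun n U => proj1_sig U)
    (fun n f _ => match f : void with end).

End OpenCore.

(* Main.v *)
Require Import Defs.
From mathcomp Require Import all_boot all_order all_algebra.
From mathcomp Require Import all_classical topology.

(* A definable family of nowhere dense subsets of the line is locally uniformly
   finite: the left endpoints of the gaps longer than e form an e-separated set,
   which uniform finiteness (applied to its final segments) makes finite, with a
   bound that does not degenerate as e tends to 0; and the points of the set are
   separated by endpoints of gaps. It follows that unions of definable chains of
   nowhere dense sets are nowhere dense, first on the line and then, by
   induction on the number of coordinates, in R^n.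

   Hence a D-sigma set has interior or is nowhere dense, and so do its
   coordinate projections. Measuring dimension by the projections with interior,
   one finds that a D-sigma set which is generically finite over d coordinates
   is, over a smaller box, closed; so its frontier has smaller dimension, and by
   induction the complement of a D-sigma set is D-sigma. As open definable sets
   and projections of D-sigma sets are D-sigma, so is every set definable in the
   open core. In dimension one the boundary of such a set is nowhere dense, so
   the local uniform finiteness of the first step applies to boundaries of
   fibers; between consecutive boundary points a definable set is constant by
   definable completeness. *)

Set Implicit Arguments.
Unset Strict Implicit.
Unset Printing Implicit Defensive.
Import Order.TTheory.
Local Open Scope order_scope.

Create HintDb defdb.

(** The bound survives as the gap length tends to 0 because the length is made a further parameter
    of the family, and uniform finiteness is applied at the value 0 of that parameter. Final
    segments enter because uniform finiteness tolerates infinite fibres: a separated set with too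
    many points has, for a suitable cut, a final segment with exactly a forbidden finite number of
    them. Limit arguments cannot use sequences or countable unions; they run along definable chains
    indexed by [R], and compactness is expressed by suprema and infima of definable sets. Under
    [LUF2] finiteness is known only near a given point, in the parameters as well as on the line.
    For frontiers that point has to be found before the bound: a compactness lemma for boxes yields
    a point at which the frontier is still large in every neighbourhood. The Baire and dimension
    arguments stay in one power [R^V]; a projection to the coordinates in [I] is kept as a cylinder,
    so the Baire property can be proved by induction on [#|I|]. *)

Section DefinablyComplete.
Variables (disp : Order.disp_t) (R : orderTopologicalType disp).
Variables (add : R -> R -> R) (zero : R).
Hypothesis R_group : densely_ordered_group add zero.
Variables (L : language) (S : structure L R).
Hypothesis S_expands : expands_ordered_group add zero S.
Hypothesis S_complete : definably_complete S.

Local Infix "+" := add : order_scope.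

(** * Definable predicates *)

Fixpoint rename_term (f : nat -> nat) (t : term L) : term L :=
  match t with
  | TVar i => TVar (f i)
  | TApp n g ts => TApp g (fun i => rename_term f (ts i))
  end.

Definition lift_renaming (f : nat -> nat) (i : nat) : nat :=
  if i is j.+1 then (f j).+1 else 0%N.

Fixpoint rename (f : nat -> nat) (phi : formula L) : formula L :=
  match phi with
  | FEq t u => FEq (rename_term f t) (rename_term f u)
  | FRel n r ts => FRel r (fun i => rename_term f (ts i))
  | FNot psi => FNot (rename f psi)
  | FAnd psi chi => FAnd (rename f psi) (rename f chi)
  | FEx psi => FEx (rename (lift_renaming f) psi)
  end.

Lemma eval_rename f (e : nat -> R) t :
  Defs.eval S e (rename_term f t) = Defs.eval S (e \o f) t.
Proof.
elim: t => [//|n g ts IH] /=; congr (fun_interp S g _).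
by apply/rowP => i; rewrite !mxE IH.
Qed.

Lemma sat_rename phi f (e : nat -> R) :
  sat S e (rename f phi) <-> sat S (e \o f) phi.
Proof.
elim: phi f e => [t u|n r ts|psi IH|psi IH1 chi IH2|psi IH] f e /=.
- by rewrite !eval_rename.
- have -> : (\row_i Defs.eval S e (rename_term f (ts i)))%R =
            (\row_i Defs.eval S (e \o f) (ts i))%R :> 'rV[R]_n.
    by apply/rowP => i; rewrite !mxE eval_rename.
  by [].
- by rewrite IH.
- by rewrite IH1 IH2.
- suff E x : push x e \o lift_renaming f = push x (e \o f).
    by split=> -[x H]; exists x; move: H; rewrite IH E.
  by apply/funext => -[].
Qed.

(** A product of copies of [R] and of powers [V -> R] is described by its coordinate functions
    alone, so that predicates on such products can be proved definable without being flattened to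
    row vectors. *)
Class ctx (G : Type) := Ctx { coord : (G -> R) -> Prop }.

Instance ctx_pt : ctx R := Ctx (fun t => t = id).
Instance ctx_fun (V : Type) : ctx (V -> R) :=
  Ctx (fun t => exists v, t = fun x => x v).
Instance ctx_prod (G H : Type) (cG : ctx G) (cH : ctx H) : ctx (G * H) :=
  Ctx (fun t => (exists2 u, coord u & t = u \o fst) \/
                (exists2 u, coord u & t = u \o snd)).

Definition dvar G (cG : ctx G) (t : G -> R) : Prop :=
  (exists c, t = fun=> c) \/ coord t.
Arguments dvar {G cG}.

(** Such maps only permute, repeat or drop coordinates and insert constants; composing with one
    changes the assignment of the free variables but not the formula. *)
Definition dmap G H (cG : ctx G) (cH : ctx H) (g : G -> H) : Prop :=
  forall t, dvar t -> dvar (t \o g).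
Arguments dmap {G H cG cH}.

Inductive dterm G (cG : ctx G) : (G -> R) -> Prop :=
| dterm_var t : dmap t -> dterm cG t
| dterm_add t u : dterm cG t -> dterm cG u -> dterm cG (fun x => t x + u x).
Arguments dterm {G cG}.

(* Definability with parameters of a predicate on a finite product of powers of
   R: the free variables of the formula are sent to coordinates or constants. *)
Definition Def G (cG : ctx G) (P : G -> Prop) : Prop :=
  exists (phi : formula L) (s : nat -> G -> R),
    (forall i, dvar (s i)) /\ forall x, P x <-> sat S (fun i => s i x) phi.
Arguments Def {G cG}.

Section Closure.
Variables (G : Type) (cG : ctx G).

Lemma Def_ext (P Q : G -> Prop) : (forall x, P x <-> Q x) -> Def P -> Def Q.
Proof.
by move=> PQ [phi [s [hs Ps]]]; exists phi, s; split=> // x; rewrite -PQ.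
Qed.

Lemma Def_not (P : G -> Prop) : Def P -> Def (fun x => ~ P x).
Proof.
by move=> [phi [s [hs Ps]]]; exists (FNot phi), s; split=> // x /=; rewrite Ps.
Qed.

(** Two formulas come with separate assignments of their variables; even and odd indices hold both
    at once. *)
Definition interleave (A : Type) (s u : nat -> A) (i : nat) : A :=
  if odd i then u i./2 else s i./2.

Lemma interleave_double A (s u : nat -> A) i : interleave s u i.*2 = s i.
Proof. by rewrite /interleave odd_double doubleK. Qed.

Lemma interleave_doubleS A (s u : nat -> A) i : interleave s u i.*2.+1 = u i.
Proof. by rewrite /interleave /= odd_double /= uphalf_double. Qed.

Lemma dvar_interleave (s u : nat -> G -> R) : (forall i, dvar (s i)) ->
  (forall i, dvar (u i)) -> forall i, dvar (interleave s u i).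
Proof. by move=> hs hu i; rewrite /interleave; case: ifP. Qed.

Lemma interleaveEl (s u : nat -> G -> R) x :
  (fun i => interleave s u i x) \o double = fun i => s i x.
Proof. by apply/funext => i /=; rewrite interleave_double. Qed.

Lemma interleaveEr (s u : nat -> G -> R) x :
  (fun i => interleave s u i x) \o (succn \o double) = fun i => u i x.
Proof. by apply/funext => i /=; rewrite interleave_doubleS. Qed.

Lemma Def_and (P Q : G -> Prop) :
  Def P -> Def Q -> Def (fun x => P x /\ Q x).
Proof.
move=> [phi [s [hs Ps]]] [psi [u [hu Qu]]].
exists (FAnd (rename double phi) (rename (succn \o double) psi)), (interleave s u).
split; first exact: dvar_interleave.
by move=> x /=; rewrite !sat_rename interleaveEl interleaveEr -Ps -Qu.
Qed.

Lemma Def_and4 (P1 P2 P3 P4 : G -> Prop) : Def P1 -> Def P2 -> Def P3 ->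
  Def P4 -> Def (fun x => [/\ P1 x, P2 x, P3 x & P4 x]).
Proof.
move=> d1 d2 d3 d4.
apply: Def_ext _ (Def_and (Def_and d1 d2) (Def_and d3 d4)) => x.
by split=> [[[? ?] []]|[]].
Qed.

Lemma Def_andb (a b : G -> bool) : Def (fun x => a x : Prop) ->
  Def (fun x => b x : Prop) -> Def (fun x => a x && b x : Prop).
Proof.
move=> da db; apply: Def_ext _ (Def_and da db) => x.
by split=> [[-> ->]|/andP].
Qed.

Lemma Def_or (P Q : G -> Prop) :
  Def P -> Def Q -> Def (fun x => P x \/ Q x).
Proof.
move=> dP dQ; apply: (@Def_ext (fun x => ~ (~ P x /\ ~ Q x))).
  by move=> x; rewrite -not_orP notK.
by apply/Def_not/Def_and; apply/Def_not.
Qed.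

Lemma Def_imp (P Q : G -> Prop) :
  Def P -> Def Q -> Def (fun x => P x -> Q x).
Proof.
move=> dP dQ; apply: (@Def_ext (fun x => ~ P x \/ Q x)).
  by move=> x; rewrite implyE.
by apply/Def_or => //; apply/Def_not.
Qed.

Lemma Def_iff (P Q : G -> Prop) :
  Def P -> Def Q -> Def (fun x => P x <-> Q x).
Proof. by move=> dP dQ; apply: Def_and; apply: Def_imp. Qed.

Lemma Def_ex_pt (P : G -> R -> Prop) :
  Def (fun p : G * R => P p.1 p.2) -> Def (fun x => exists t, P x t).
Proof.
move=> [phi [s [hs Ps]]].
have /choice[u hu] : forall i, exists u : G -> R,
    dvar u /\ (s i = snd \/ s i = u \o fst).
  move=> i; case: (hs i) => [[c ->]|[[u hu ->]|[u -> ->]]].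
  - by exists (fun=> c); split; [left; exists c|right].
  - by exists u; split; [right|right].
  - by exists (fun=> zero); split; [left; exists zero|left].
(* All variables that read the last coordinate become the bound variable 0; the others are shifted
   by one. *)
exists (FEx (rename (fun i => if `[< s i = snd >] then 0%N else i.+1) phi)), u.
split; first by move=> i; case: (hu i).
move=> x /=; set f : nat -> nat := fun i => _.
suff E t : push t (fun i => u i x) \o f = fun i => s i (x, t).
  by split=> -[t Pt]; exists t; move: Pt; rewrite sat_rename E -(Ps (x, t)).
apply/funext => i; rewrite /f /=; case: asboolP => [->//|ns].
by case: (hu i) => _ [//|->].
Qed.

Lemma Def_const (P : Prop) : Def (fun _ : G => P).
Proof.
have [hP|hP] := pselect P.
  exists (FEq (TVar 0) (TVar 0)), (fun _ _ => zero).
  by split=> [i|x //]; left; exists zero.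
exists (FNot (FEq (TVar 0) (TVar 0))), (fun _ _ => zero).
by split=> [i|x /=]; [left; exists zero|split=> // -[]].
Qed.

Lemma dmap_id : dmap (fun x : G => x).
Proof. by []. Qed.

Lemma dmap_const (H : Type) (cH : ctx H) (h : H) : dmap (fun _ : G => h).
Proof. by move=> t _; left; exists (t h). Qed.

Lemma dmap_fst (H K : Type) (cH : ctx H) (cK : ctx K) (g : G -> H * K) :
  dmap g -> dmap (fun x => (g x).1).
Proof.
move=> dg t [[c ->]|ct]; first by left; exists c.
by apply: (dg (t \o fst)); right; left; exists t.
Qed.

Lemma dmap_snd (H K : Type) (cH : ctx H) (cK : ctx K) (g : G -> H * K) :
  dmap g -> dmap (fun x => (g x).2).
Proof.
move=> dg t [[c ->]|ct]; first by left; exists c.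
by apply: (dg (t \o snd)); right; right; exists t.
Qed.

Lemma dmap_pair (H K : Type) (cH : ctx H) (cK : ctx K) (g : G -> H) (k : G -> K) :
  dmap g -> dmap k -> dmap (fun x => (g x, k x)).
Proof.
move=> dg dk t [[c ->]|[[u cu ->]|[u cu ->]]]; first by left; exists c.
  by apply: (dg u); right.
by apply: (dk u); right.
Qed.

Lemma dmap_app (V : Type) (g : G -> V -> R) v :
  dmap g -> dmap (fun x => g x v).
Proof.
move=> dg t [[c ->]|->]; first by left; exists c.
by apply: (dg (fun x => x v)); right; exists v.
Qed.

Lemma dmap_lam (V : Type) (g : G -> V -> R) :
  (forall v, dmap (fun x => g x v)) -> dmap g.
Proof.
move=> dg t [[c ->]|[v ->]]; first by left; exists c.
by apply: (dg v id); right.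
Qed.

Lemma Def_comp (H : Type) (cH : ctx H) (Q : H -> Prop) (g : G -> H) :
  Def Q -> dmap g -> Def (fun x => Q (g x)).
Proof.
move=> [phi [s [hs Qs]]] dg; exists phi, (fun i => s i \o g).
by split=> [i|x]; [exact: dg|exact: Qs].
Qed.

Lemma dterm_eval (t : G -> R) : dterm t -> exists (T : term L) (s : nat -> G -> R),
  (forall i, dvar (s i)) /\ forall x, t x = Defs.eval S (fun i => s i x) T.
Proof.
elim=> {t} [t dt|t u _ [T [s [hs Ts]]] _ [U [v [hv Uv]]]].
  by exists (TVar 0), (fun=> t); split=> [i|x//]; apply: (dt id); right.
have [_ [f fE] _] := S_expands.
exists (TApp f (fun i => if (i : nat) == 0%N then rename_term double T
                else rename_term (succn \o double) U)), (interleave s v).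
split; first exact: dvar_interleave.
move=> x /=; rewrite fE !mxE /= !eval_rename interleaveEl interleaveEr.
by rewrite -Ts -Uv.
Qed.

Lemma Def_lt (t u : G -> R) : dterm t -> dterm u -> Def (fun x => t x < u x).
Proof.
move=> /dterm_eval[T [s [hs Ts]]] /dterm_eval[U [v [hv Uv]]].
have [[r rE] _ _] := S_expands.
exists (FRel r (fun i => if (i : nat) == 0%N then rename_term double T
                else rename_term (succn \o double) U)), (interleave s v).
split; first exact: dvar_interleave.
move=> x /=; rewrite rE !mxE /= !eval_rename interleaveEl interleaveEr.
by rewrite -Ts -Uv.
Qed.

Lemma Def_le (t u : G -> R) : dterm t -> dterm u -> Def (fun x => t x <= u x).
Proof.
move=> dt du; apply: (@Def_ext (fun x => ~ (u x < t x))).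
  by move=> x; rewrite leNgt; split=> /negP.
by apply/Def_not/Def_lt.
Qed.

Lemma Def_eq (t u : G -> R) : dterm t -> dterm u -> Def (fun x => t x = u x).
Proof.
move=> dt du; apply: (@Def_ext (fun x => t x <= u x /\ u x <= t x)).
  by move=> x; split=> [[h1 h2]|->//]; apply/le_anti/andP.
by apply/Def_and; apply/Def_le.
Qed.

Lemma Def_all_fin (I : finType) (P : I -> G -> Prop) :
  (forall i, Def (P i)) -> Def (fun x => forall i, P i x).
Proof.
move=> dP.
suff H (r : seq I) : @Def G cG (fun x => forall i, i \in r -> P i x).
  refine (Def_ext _ (H (enum I))) => x.
  by split=> h i; [apply: h; rewrite mem_enum|move=> _].
elim: r => [|j r IH]; first by apply: Def_ext _ (Def_const True).
apply: Def_ext _ (Def_and (dP j) IH) => x; split.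
  by move=> [hj hr] i; rewrite inE => /orP[/eqP->//|/hr].
by move=> h; split=> [|i ir]; apply: h; rewrite inE ?eqxx ?ir ?orbT.
Qed.

Lemma Def_ex_fin (I : finType) (P : I -> G -> Prop) :
  (forall i, Def (P i)) -> Def (fun x => exists i, P i x).
Proof.
move=> dP; apply: (@Def_ext (fun x => ~ forall i, ~ P i x)).
  by move=> x; split=> [/existsNP[i /contrapT]|[i Pi] /(_ i)]; [exists i|].
by apply/Def_not/Def_all_fin => i; apply/Def_not.
Qed.

End Closure.

Lemma Def_all_pt G (cG : ctx G) (P : G -> R -> Prop) :
  Def (fun p : G * R => P p.1 p.2) -> Def (fun x => forall t, P x t).
Proof.
move=> dP; apply: (@Def_ext _ _ (fun x => ~ exists t, ~ P x t)).
  by move=> x; rewrite -forallNP; split=> h t;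
    [exact: contrapT (h t)|by move=> n; exact: n (h t)].
by apply/Def_not/Def_ex_pt/Def_not.
Qed.

Definition upd (V : eqType) (x : V -> R) (j : V) (t : R) (i : V) : R :=
  if i == j then t else x i.

Lemma upd_same (V : eqType) (x : V -> R) j t : upd x j t j = t.
Proof. by rewrite /upd eqxx. Qed.

Lemma upd_neq (V : eqType) (x : V -> R) j t i : i != j -> upd x j t i = x i.
Proof. by rewrite /upd => /negbTE ->. Qed.

Lemma upd_id (V : eqType) (x : V -> R) j : upd x j (x j) = x.
Proof. by apply/funext => i; rewrite /upd; case: eqP => // ->. Qed.

Lemma dmap_upd G (cG : ctx G) (V : eqType) (g : G -> V -> R) j (t : G -> R) :
  dmap g -> dmap t -> dmap (fun x => upd (g x) j (t x)).
Proof.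
move=> dg dt; apply: dmap_lam => i; rewrite /upd.
by case: eqP => [//|_]; apply: dmap_app.
Qed.

(** A quantifier over [R^V] is a finite string of quantifiers over [R]: in the auxiliary predicate
    only the coordinates listed in [r] are quantified, the others being read from the given
    point. *)
Lemma Def_ex_fun G (cG : ctx G) (V : finType) (P : G -> (V -> R) -> Prop) :
  Def (fun p : G * (V -> R) => P p.1 p.2) -> Def (fun x => exists y, P x y).
Proof.
move=> dP; suff H (r : seq V) : @Def _ (ctx_prod cG (ctx_fun V)) (fun p : G * (V -> R) =>
    exists y, (forall i, i \notin r -> y i = p.2 i) /\ P p.1 y).
  apply: (Def_ext _ (@Def_comp _ _ _ _ _ (fun x => (x, fun=> zero))
    (H (enum V)) _)); last exact/dmap_pair/dmap_const/dmap_id.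
  move=> x /=; split=> -[y]; first by case=> _; exists y.
  by exists y; split=> // i; rewrite mem_enum.
elim: r => [|j r IH].
  apply: Def_ext _ dP => -[x y] /=; split; first by exists y.
  by move=> [z [/(_ _ isT) zy]]; rewrite (_ : z = y)//; apply/funext.
have dg : @dmap _ _ (ctx_prod (ctx_prod cG (ctx_fun V)) ctx_pt)
    (ctx_prod cG (ctx_fun V))
    (fun p : G * (V -> R) * R => (p.1.1, upd p.1.2 j p.2)).
  apply: dmap_pair; first exact/dmap_fst/dmap_fst/dmap_id.
  apply: dmap_upd; last exact/dmap_snd/dmap_id.
  exact/dmap_snd/dmap_fst/dmap_id.
apply: Def_ext _ (@Def_ex_pt _ _ (fun p t => exists y,
  (forall i, i \notin r -> y i = upd p.2 j t i) /\ P p.1 y)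
  (Def_comp IH dg)) => -[x y] /=; split.
  move=> [t [z [/= zy Pz]]]; exists z; split=> // i.
  by rewrite inE negb_or => /andP[ij ir]; rewrite zy ?upd_neq.
move=> [z [zy Pz]]; exists (z j), z; split=> // i ir; rewrite /upd.
by case: eqP => [->//|/eqP ij]; rewrite zy// inE negb_or ij.
Qed.

Lemma Def_all_fun G (cG : ctx G) (V : finType) (P : G -> (V -> R) -> Prop) :
  Def (fun p : G * (V -> R) => P p.1 p.2) -> Def (fun x => forall y, P x y).
Proof.
move=> dP; apply: (@Def_ext _ _ (fun x => ~ exists y, ~ P x y)).
  by move=> x; rewrite -forallNP; split=> h t;
    [exact: contrapT (h t)|by move=> n; exact: n (h t)].
by apply/Def_not/Def_ex_fun/Def_not.
Qed.

(** * Ordered group and boxes *)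

Lemma addC : commutative add. Proof. by case: R_group. Qed.
Lemma addA : associative add. Proof. by case: R_group. Qed.
Lemma add0 : left_id zero add. Proof. by case: R_group. Qed.

(** Opposites are only known to exist, so [x - e] is represented throughout by a [c] with
    [c + e = x]. *)
Lemma sub_ex x e : exists c, c + e = x.
Proof.
case: (R_group) => _ _ _ [opp oppK] _ _ _.
by exists (x + opp e); rewrite -addA oppK addC add0.
Qed.

Lemma lt_add2r z x y : (x + z < y + z) = (x < y).
Proof.
have mono u v : u < v -> u + z < v + z by apply: dog_translate R_group _ _ _.
case: (ltgtP x y) => [/mono->//|/mono/ltW|->]; last by rewrite ltxx.
by rewrite leNgt => /negbTE.
Qed.

Lemma le_add2r z x y : (x + z <= y + z) = (x <= y).
Proof. by rewrite !leNgt lt_add2r. Qed.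

Lemma lt_add2l z x y : (z + x < z + y) = (x < y).
Proof. by rewrite !(addC z) lt_add2r. Qed.

Lemma le_add2l z x y : (z + x <= z + y) = (x <= y).
Proof. by rewrite !(addC z) le_add2r. Qed.

Lemma lt_addr x e : (x < x + e) = (zero < e).
Proof. by rewrite -{1}(add0 x) (addC zero) lt_add2l. Qed.

Lemma le_addr x e : (x <= x + e) = (zero <= e).
Proof. by rewrite -{1}(add0 x) (addC zero) le_add2l. Qed.

Lemma le_add x y z t : x <= y -> z <= t -> x + z <= y + t.
Proof.
by move=> xy zt; apply: (le_trans (y := y + z)); rewrite ?le_add2r ?le_add2l.
Qed.

Lemma lt_subE (x y : R) : x < y -> exists2 e, zero < e & y = x + e.
Proof.
by have [e <-] := sub_ex y x; rewrite addC => xy; exists e => //; rewrite -(lt_addr x).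
Qed.

Lemma pos_ex : exists e, zero < e.
Proof.
case: (R_group) => _ _ _ _ _ _ [x]; case: (ltgtP x zero) => // [x0 _|]; last by exists x.
by have [e e0 _] := lt_subE x0; exists e.
Qed.

Lemma dense (x y : R) : x < y -> exists2 z, x < z & z < y.
Proof. by case: (R_group) => _ _ _ _ _ h _ /h[z /andP[]]; exists z. Qed.

(** Density replaces division by two: [e] is split as [f + g] and the smaller part is taken. *)
Lemma half_ex e : zero < e -> exists2 f, zero < f & f + f <= e.
Proof.
move=> /dense[f f0 /lt_subE[g g0 ->]]; exists (Order.min f g).
  by rewrite lt_min f0.
by apply: le_add; rewrite ge_min lexx ?orbT.
Qed.

Lemma gt_ex (x : R) : exists y, x < y.
Proof. by have [e e0] := pos_ex; exists (x + e); rewrite lt_addr. Qed.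

Lemma lt_ex (x : R) : exists y, y < x.
Proof.
by have [e e0] := pos_ex; have [c <-] := sub_ex x e; exists c; rewrite lt_addr.
Qed.

(* The distance of [x] and [y] is less than [e], stated without subtraction. *)
Definition near (e x y : R) : Prop := x < y + e /\ y < x + e.

Lemma nearC e x y : near e x y -> near e y x.
Proof. by case. Qed.

Lemma near_refl e x : zero < e -> near e x x.
Proof. by rewrite /near lt_addr. Qed.

Lemma near_le e f x y : e <= f -> near e x y -> near f x y.
Proof.
by move=> ef [h1 h2]; split; apply: lt_le_trans; [exact: h1| |exact: h2|];
  rewrite le_add2l.
Qed.

Lemma near_trans y e f x z : near e x y -> near f y z -> near (e + f) x z.
Proof.
move=> [h1 h2] [h3 h4]; split.
  by apply: (lt_trans h1); rewrite (addC e) addA lt_add2r.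
by apply: (lt_trans h4); rewrite addA lt_add2r.
Qed.

Lemma near_itv c x y : c < x -> x < y ->
  exists2 e, zero < e & forall z, near e x z -> c < z /\ z < y.
Proof.
move=> /lt_subE[e e0 ->] /lt_subE[f f0 ->]; exists (Order.min e f).
  by rewrite lt_min e0.
move=> z [h1 h2]; split; last by apply: (lt_le_trans h2); rewrite le_add2l ge_min lexx orbT.
rewrite -(lt_add2r e); apply: (lt_le_trans h1).
by rewrite le_add2l ge_min lexx.
Qed.

Lemma nearE e x : exists c y, [/\ c + e = x, y = x + e &
  forall z, near e x z <-> c < z /\ z < y].
Proof.
have [c cx] := sub_ex x e; exists c, (x + e); split=> // z.
by rewrite /near -{1}cx lt_add2r.
Qed.

Lemma near_open e x y : near e x y ->
  exists2 f, zero < f & forall z, near f y z -> near e x z.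
Proof.
have [c [t [_ _ E]]] := nearE e x; move=> /E[cy yt].
by have [f f0 h] := near_itv cy yt; exists f => // z /h /E.
Qed.

Lemma fin_eps (V : finType) (P : V -> R -> Prop) :
  (forall i, exists2 e, zero < e & forall f, zero < f -> f <= e -> P i f) ->
  exists2 e, zero < e & forall i f, zero < f -> f <= e -> P i f.
Proof.
move=> H; suff [e e0 h] : exists2 e, zero < e &
    forall i, i \in enum V -> forall f, zero < f -> f <= e -> P i f.
  by exists e => // i; apply: h; rewrite mem_enum.
elim: (enum V) => [|i r [e e0 IH]]; first by have [e e0] := pos_ex; exists e.
have [g g0 h] := H i; exists (Order.min e g); first by rewrite lt_min e0.
move=> j; rewrite inE => /orP[/eqP->|jr] f f0; rewrite le_min => /andP[fe fg].
  exact: h.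
exact: IH.
Qed.

(** A box of [R^I] seen as a cylinder in [R^V]: coordinates outside [I] are unconstrained. *)
Definition ball (V : finType) (I : {set V}) e (x y : V -> R) :=
  forall i, i \in I -> near e (x i) (y i).

Section Ball.
Variables (V : finType) (I : {set V}).
Implicit Types x y z : V -> R.

Lemma ballC e x y : ball I e x y -> ball I e y x.
Proof. by move=> h i /h/nearC. Qed.

Lemma ball_refl e x : zero < e -> ball I e x x.
Proof. by move=> e0 i _; apply: near_refl. Qed.

Lemma ball_le e f x y : e <= f -> ball I e x y -> ball I f x y.
Proof. by move=> ef h i /h; apply: near_le. Qed.

Lemma ball_trans y e f x z : ball I e x y -> ball I f y z -> ball I (e + f) x z.
Proof. by move=> h1 h2 i iI; apply: (near_trans (h1 i iI)); apply: h2. Qed.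

Lemma ball_open e x y : ball I e x y ->
  exists2 f, zero < f & forall z, ball I f y z -> ball I e x z.
Proof.
move=> h; have [i|f f0 H] := @fin_eps V (fun i f =>
    i \in I -> forall t, near f (y i) t -> near e (x i) t).
  have [iI|niI] := boolP (i \in I).
    have [g g0 hg] := near_open (h i iI); exists g => // f f0 fg _ t /(near_le fg).
    exact: hg.
  by have [g g0] := pos_ex; exists g.
by exists f => // z hz i iI; apply: (H i f) => //; apply: hz.
Qed.

Lemma ball_eqr e x y z : (forall i, i \in I -> y i = z i) ->
  ball I e x y -> ball I e x z.
Proof. by move=> yz h i iI; rewrite -yz//; apply: h. Qed.

End Ball.

Lemma ball_sub (V : finType) (I J : {set V}) e (x y : V -> R) :
  I \subset J -> ball J e x y -> ball I e x y.
Proof. by move=> /fintype.subsetP IJ h i /IJ/h. Qed.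

Lemma ballU1 (V : finType) (I : {set V}) j e (x y : V -> R) :
  ball (j |: I) e x y <-> near e (x j) (y j) /\ ball I e x y.
Proof.
split=> [h|[hj hI] i]; first by split=> [|i iI]; apply: h; rewrite !inE ?eqxx ?iI ?orbT.
by rewrite !inE => /orP[/eqP->|/hI].
Qed.

(** * From [Def] to definable sets of row vectors; suprema and infima *)

Lemma Def_definable n (P : ('I_n -> R) -> Prop) :
  Def P -> definable S [set v : 'rV[R]_n | P (fun i => v ord0 i)].
Proof.
move=> [phi [s [hs Ps]]].
have /choice[u hu] : forall i, exists u : 'I_n + R,
    s i = match u with inl j => fun x => x j | inr c => fun=> c end.
  by move=> i; case: (hs i) => [[c ->]|[j ->]]; [exists (inr c)|exists (inl j)].
exists (rename (fun i => if u i is inl j then j : nat else (n + i)%N) phi).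
exists (fun i => if u i is inr c then c else zero).
apply/funext => v; apply: propext; rewrite /= sat_rename (Ps _).
set e1 := (X in sat _ X _); set e2 := (X in _ <-> sat _ X _).
suff -> : e1 = e2 by [].
apply/funext => i; rewrite /e1 /e2 /= hu; case ui: (u i) => [j|c]; rewrite /assign.
  by have -> : insub (j : nat) = Some j by exact: valK.
have -> : insub (n + i)%N = None :> option 'I_n by apply: insubF; rewrite ltnNge leq_addr.
by rewrite addKn ui.
Qed.

Lemma definable_Def n (X : set 'rV[R]_n) :
  definable S X -> Def (fun x : 'I_n -> R => X (\row_i x i)%R).
Proof.
move=> [phi [e ->]].
exists phi, (fun i => if insub i is Some j then fun x => x j else fun=> e (i - n)%N).
split; first by move=> i; case: insub => [j|]; [right; exists j|left; eexists].
move=> x /=; match goal with |- sat _ ?e _ <-> sat _ ?f _ => suff -> : e = f by [] end.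
by apply/funext => i; rewrite /assign; case: insub => // j; rewrite mxE.
Qed.

Lemma Def_definable1 (P : R -> Prop) : Def P -> definable1 S P.
Proof.
move=> dP; apply: (@Def_definable 1 (fun x => P (x ord0))).
refine (@Def_comp _ _ _ _ P (fun x => x ord0) dP _).
exact: (@dmap_app _ _ _ (fun x => x) ord0 (@dmap_id _ _)).
Qed.

Lemma sup_ex (P : R -> Prop) : Def P -> (exists x, P x) ->
  (exists b, forall x, P x -> x <= b) ->
  exists s, (forall x, P x -> x <= s) /\ forall b, (forall x, P x -> x <= b) -> s <= b.
Proof.
move=> /Def_definable1/S_complete[[s [ub lb]] _] [x Px] [b Pb]; case: s ub lb => [s||].
- move=> ub lb; exists s; split=> [y /ub//|c Pc]; exact: (lb (constructive_ereal.EFin c) Pc).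
- by move=> _ /(_ (constructive_ereal.EFin b) Pb).
- by move=> /(_ _ Px).
Qed.

Lemma inf_ex (P : R -> Prop) : Def P -> (exists x, P x) ->
  (exists b, forall x, P x -> b <= x) ->
  exists s, (forall x, P x -> s <= x) /\ forall b, (forall x, P x -> b <= x) -> b <= s.
Proof.
move=> /Def_definable1/S_complete[_ [s [lb ub]]] [x Px] [b Pb]; case: s lb ub => [s||].
- move=> lb ub; exists s; split=> [y /lb//|c Pc]; exact: (ub (constructive_ereal.EFin c) Pc).
- by move=> /(_ _ Px).
- by move=> _ /(_ (constructive_ereal.EFin b) Pb).
Qed.

(* Automation of definability proofs *)
#[local] Hint Unfold near ball : defdb.

Ltac dmap_step :=
  cbv beta;
  lazymatch goal with
  | |- dmap (fun _ => ?c) => exact: dmap_const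
  | |- dmap (fun x => x) => exact: dmap_id
  | |- dmap id => exact: dmap_id
  | |- dmap fst => refine (@dmap_fst _ _ _ _ _ _ (fun x => x) _)
  | |- dmap snd => refine (@dmap_snd _ _ _ _ _ _ (fun x => x) _)
  | |- dmap (fun x => fst (@?g x)) => refine (@dmap_fst _ _ _ _ _ _ g _)
  | |- dmap (fun x => snd (@?g x)) => refine (@dmap_snd _ _ _ _ _ _ g _)
  | |- dmap (fun x => pair (@?g x) (@?h x)) => refine (@dmap_pair _ _ _ _ _ _ g h _ _)
  | |- dmap (fun x => upd (@?g x) ?j (@?t x)) => refine (@dmap_upd _ _ _ g j t _ _)
  | |- dmap (fun x => if ?b then _ else _) => case: b
  | |- dmap (fun x i => _) => apply: dmap_lam => ?
  | |- @dmap ?G _ _ _ ?f =>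
      (* The function applied to [v] is read off the body at a fresh point. *)
      let g := constr:(fun point : G => ltac:(
        let b := eval cbv beta in (f point) in
        lazymatch b with ?h _ => exact h end)) in
      lazymatch f with fun x => _ ?v => refine (@dmap_app _ _ _ g v _) end
  end.
Ltac dmap_auto := repeat dmap_step.
Ltac dterm_auto :=
  cbv beta;
  lazymatch goal with
  | |- dterm (fun x => add (@?t x) (@?u x)) =>
      refine (@dterm_add _ _ t u _ _); dterm_auto
  | |- dterm _ => apply: dterm_var; dmap_auto
  end.
Ltac def_step :=
  cbv beta;
  lazymatch goal with
  | |- Def (fun _ => ?P) => exact: Def_const
  | |- Def (fun x => and (@?P x) (@?Q x)) => refine (@Def_and _ _ P Q _ _)
  | |- Def (fun x => and4 (@?P x) (@?Q x) (@?P' x) (@?Q' x)) =>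
      refine (@Def_and4 _ _ P Q P' Q' _ _ _ _)
  | |- Def (fun x => or (@?P x) (@?Q x)) => refine (@Def_or _ _ P Q _ _)
  | |- Def (fun x => iff (@?P x) (@?Q x)) => refine (@Def_iff _ _ P Q _ _)
  | |- Def (fun x => not (@?P x)) => refine (@Def_not _ _ P _)
  | |- Def (fun x => (@?P x) -> (@?Q x)) =>
      first [refine (@Def_imp _ _ P Q _ _) | apply: Def_all_pt | apply: Def_all_fun
            | apply: Def_all_fin => ?]
  | |- Def (fun x => forall y, _) =>
      first [apply: Def_all_pt | apply: Def_all_fun | apply: Def_all_fin => ?]
  | |- Def (fun x => exists y, _) =>
      first [apply: Def_ex_pt | apply: Def_ex_fun | apply: Def_ex_fin => ?]
  | |- Def (fun x => is_true (Order.lt (@?t x) (@?u x))) =>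
      refine (@Def_lt _ _ t u _ _); dterm_auto
  | |- Def (fun x => is_true (Order.le (@?t x) (@?u x))) =>
      refine (@Def_le _ _ t u _ _); dterm_auto
  | |- Def (fun x => is_true (andb (@?a x) (@?b x))) =>
      refine (@Def_andb _ _ a b _ _)
  | |- Def (fun x => @eq (Order.Total.sort _) (@?t x) (@?u x)) =>
      refine (@Def_eq _ _ t u _ _); dterm_auto
  | |- Def (fun x => @eq _ (@?t x) (@?u x)) =>
      refine (@Def_eq _ _ t u _ _); dterm_auto
  | |- Def _ =>
    match goal with
    | H : Def ?A |- Def ?A => exact: H
    | H : Def ?A |- Def (fun x => ?A (@?f x)) =>
        refine (@Def_comp _ _ _ _ A f H _); dmap_auto
    | H : Def (fun p => ?A p.1 p.2) |- Def (?A ?x) =>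
        refine (@Def_comp _ _ _ _ _ (fun t => (x, t)) H _); dmap_auto
    | H : Def (fun p => ?A p.1 p.2) |- Def (fun x => ?A (@?f x) (@?g x)) =>
        refine (@Def_comp _ _ _ _ _ (fun x => (f x, g x)) H _); dmap_auto
    | H : Def (fun p => ?A p.1.1 p.1.2 p.2) |- Def (fun x => ?A (@?f x) (@?g x) (@?h x)) =>
        refine (@Def_comp _ _ _ _ _ (fun x => (f x, g x, h x)) H _); dmap_auto
    end
  end.
Ltac def_auto := autounfold with defdb; repeat def_step.

(** * Counting points of nowhere dense sets *)

Fixpoint at_least (T : Type) (k : nat) (A : T -> Prop) : Prop :=
  if k is j.+1 then exists2 x, A x & at_least j (fun y => A y /\ y <> x) else True.

Lemma at_least_sub (T : Type) k (A B : T -> Prop) :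
  (forall x, A x -> B x) -> at_least k A -> at_least k B.
Proof.
elim: k A B => [//|k IH] A B AB [x Ax h]; exists x; first exact: AB.
by apply: IH h => y [/AB].
Qed.

Lemma at_least_ext (T : Type) k (A B : T -> Prop) z :
  (forall x, A x -> B x) -> B z -> ~ A z -> at_least k A -> at_least k.+1 B.
Proof.
move=> AB Bz nAz h; exists z => //.
by apply: at_least_sub h => x Ax; split; [exact: AB|move=> xz; rewrite xz in Ax].
Qed.

Lemma at_least_del (T : Type) k (A : T -> Prop) z :
  at_least k.+1 A -> at_least k (fun y => A y /\ y <> z).
Proof.
elim: k A => [//|k IH] A [x Ax h].
have [zx|xz] := pselect (x = z); first by rewrite -zx.
exists x => //; apply: at_least_sub (IH _ h) => y [[Ay yx] yz] //.
Qed.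

(** Each of the [k] points lies in some member, and finitely many members of a chain have a largest
    one; [i0] answers the case [k = 0]. *)
Lemma at_least_chain (T I : Type) (i0 : I) k (A : I -> T -> Prop) :
  (forall i j, (forall x, A i x -> A j x) \/ (forall x, A j x -> A i x)) ->
  at_least k (fun x => exists i, A i x) -> exists i, at_least k (A i).
Proof.
elim: k A => [|k IH] A ch; first by exists i0.
move=> [x [i Aix] h].
have [||j hj] := IH (fun i y => A i y /\ y <> x).
- by move=> a b; case: (ch a b) => h'; [left|right] => y [/h'].
- by apply: at_least_sub h => y [[j Ajy] yx]; exists j.
case: (ch i j) => h'; first by exists j, x => //; exact: h'.
by exists i, x => //; apply: at_least_sub hj => y [/h'].
Qed.

Lemma at_least_card (T : Type) (J : finType) (f : J -> T) k (A : T -> Prop) :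
  (forall x, A x -> exists i, x = f i) -> at_least k A -> (k <= #|J|)%N.
Proof.
move=> Af; rewrite -cardsT.
have {Af} : forall x, A x -> exists2 i, i \in [set: J]%SET & x = f i.
  by move=> x /Af[i ->]; exists i.
elim: k A [set: J]%SET => [//|k IH] A D AD [x /[dup] Ax /AD[i iD xi] h].
rewrite (cardsD1 i) iD ltnS; apply: IH h => y [/AD[j jD yj] yx].
by exists j => //; rewrite !inE jD andbT; apply: contra_not_neq yx => ji; rewrite yj xi ji.
Qed.

Lemma at_least_map (T U : Type) (g : T -> U) k (A : T -> Prop) :
  (forall x y, A x -> A y -> g x = g y -> x = y) -> at_least k A ->
  at_least k (fun z => exists2 x, A x & z = g x).
Proof.
elim: k A => [//|k IH] A inj [x Ax h]; exists (g x); first by exists x.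
apply: at_least_sub (IH _ _ h) => [z [y [Ay yx] ->]|y z [Ay _] [Az _]]; last exact: inj.
by split=> [|/inj]; [exists y|auto].
Qed.

Lemma not_at_least_seq (T : eqType) k (A : T -> Prop) : ~ at_least k A ->
  exists2 s : seq T, (size s < k)%N & forall x, A x <-> x \in s.
Proof.
elim: k A => [A []//|k IH] A h.
have [[x Ax]|nA] := pselect (exists x, A x); last first.
  by exists [::] => // x; split=> // Ax; case: nA; exists x.
have [|s ss sE] := IH (fun y => A y /\ y <> x); first by move=> h'; apply: h; exists x.
exists (x :: s) => // y; rewrite inE; split=> [Ay|/predU1P[->//|/sE[]//]].
by have [->|/eqP yx] := eqVneq y x; rewrite ?eqxx //=; apply/sE.
Qed.

Lemma infinite_at_least (A : set R) k : infinite_set A -> at_least k A.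
Proof.
move=> iA; apply: contrapT => /not_at_least_seq[s _ sE]; apply: iA.
by apply/finite_seqP; exists s; apply/seteqP; split=> x /= /sE.
Qed.

Lemma card_le_not_at_least (A : set R) N : (A #<= `I_N)%card -> ~ at_least N.+1 A.
Proof.
case/pcard_leP => f h.
have h1 := @at_least_map _ _ f N.+1 A
  (fun x y Ax Ay => @inj _ _ _ f x y (mem_set Ax) (mem_set Ay)) h.
have := @at_least_card _ _ (fun i : 'I_N => i : nat) _ _ _ h1.
rewrite card_ord ltnn => H; suff : false by []; apply: H => x [y Ay ->].
have fN : (f y < N)%N by exact: (@funS _ _ _ _ f y Ay).
by exists (Ordinal fN).
Qed.

Definition nwd1 (A : R -> Prop) : Prop := forall c d, c < d -> exists c' d',
  [/\ c <= c', c' < d', d' <= d & forall y, c' < y -> y < d' -> ~ A y].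

(** If there were [N] points, a cut moved down from [d] past one point at a time would leave a final
    segment with exactly [N] points, which the dichotomy rules out. The room between [v] and [c]
    allows a cut to the left of all points. *)
Lemma separated_few (B : R -> Prop) e v c d N : Def B -> zero < e ->
  (forall t u, B t -> B u -> t < u -> t + e <= u) -> v < c -> c < d ->
  (forall s, v < s -> s <= d ->
     (forall k, at_least k (fun t => B t /\ s < t /\ c <= t <= d)) \/
     ~ at_least N (fun t => B t /\ s < t /\ c <= t <= d)) ->
  ~ at_least N (fun t => B t /\ c <= t <= d).
Proof.
move=> dB e0 sep vc cd H h.
suff [s [vs sd h1 h2]] : exists s, [/\ v < s, s <= d,
    at_least N (fun t => B t /\ s < t /\ c <= t <= d) &
    ~ at_least N.+1 (fun t => B t /\ s < t /\ c <= t <= d)].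
  by case: (H s vs sd) => [/(_ N.+1)/h2|/(_ h1)].
elim: N h {H} => [_|k IH h].
  exists d; split=> //=; first exact: lt_trans cd.
  by move=> [t [_ [dt /andP[_ td]]]]; move: (lt_le_trans dt td); rewrite ltxx.
have [|s [vs sd h1 h2]] := IH.
  apply: at_least_sub (at_least_del c h); by move=> x [].
pose E t := B t /\ c <= t <= d /\ t <= s.
have dE : Def E by rewrite /E; def_auto.
have [t0 Et0] : exists t, E t.
  apply: contrapT => nE; apply: h2; apply: at_least_sub h => t [Bt /andP[ct td]].
  split=> //; split; last by rewrite ct.
  by rewrite ltNge; apply/negP => ts; apply: nE; exists t; rewrite /E ct td.
(* By separation this supremum is attained: a point of [E] closer than [e] to it is the largest. *)
have [tau [ub lb]] := sup_ex dE (ex_intro _ _ Et0)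
  (ex_intro _ s (fun x (Ex : E x) => Ex.2.2)).
have [t Et tt] : exists2 t, E t & tau < t + e.
  apply: contrapT => nt; have [w we] := sub_ex tau e.
  have /lb : forall x, E x -> x <= w.
    move=> x Ex; rewrite -(le_add2r e) we leNgt; apply/negP => xt.
    by apply: nt; exists x.
  by rewrite -we leNgt lt_addr e0.
have tmax u : E u -> u <= t.
  move=> Eu; rewrite leNgt; apply/negP => tu.
  have := sep _ _ Et.1 Eu.1 tu; rewrite leNgt; apply/negP; rewrite negbK.
  exact: le_lt_trans (ub _ Eu) tt.
case: (Et) => Bt [/andP[ct td] ts].
have [w we] := sub_ex t e.
(* Above [w], which is [t - e], so that [t] is the only point gained; above [v], so that the
   dichotomy applies to the new cut. *)
have [s' ] : exists2 s', Order.max v w < s' & s' < t.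
  by apply: dense; rewrite gt_max (lt_le_trans vc ct) -we lt_addr.
rewrite gt_max => /andP[vs' ws'] s't.
exists s'; split=> //; first by apply/ltW/(lt_le_trans s't).
  apply: (at_least_ext (z := t) _ _ _ h1).
  - by move=> x [Bx [sx cd']]; do !split=> //; apply: lt_trans sx; apply: lt_le_trans ts.
  - by rewrite ct td.
  - by move=> [_ [+ _]]; rewrite ltNge ts.
move=> h3; apply: h2; apply: at_least_sub (at_least_del t h3) => u [[Bu [su cud]] ut].
split=> //; split=> //; rewrite ltNge; apply/negP => us.
have ult : u < t by rewrite lt_neqAle tmax ?andbT //; apply/eqP.
have := sep _ _ Bu Bt ult; rewrite -we le_add2r leNgt => /negP; apply.
exact: lt_trans su.
Qed.

(* Left endpoints of the complementary intervals of the closure of [A] that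
   have length at least [e]. *)
Definition gap_start (A : R -> Prop) e t : Prop :=
  zero < e /\ (forall f, zero < f -> exists u, A u /\ near f t u) /\
  forall u, t < u -> u < t + e -> ~ A u.

(** Take a hole [(c, d)] of [A] between [p] and [q]. The supremum [t] of the points of [A] up to [c]
    starts a gap that reaches at least to [d], and any smaller [e] may be recorded as its length, in
    particular one below [D]. *)
Lemma gap_start_between (A : R -> Prop) p q D : Def A -> nwd1 A -> A p ->
  p < q -> zero < D ->
  exists e t, [/\ e < D, gap_start A e t, p <= t & t < q].
Proof.
move=> dA nA Ap pq D0; have [c [d [pc cd dq nAcd]]] := nA p q pq.
pose E u := A u /\ u <= c.
have dE : Def E by rewrite /E; def_auto.
have [t [ub lb]] := sup_ex dE (ex_intro _ p (conj Ap pc))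
  (ex_intro _ c (fun x (Ex : E x) => Ex.2)).
have tc : t <= c by apply: lb => x [].
have td : t < d by apply: le_lt_trans cd.
have [e0 e00 de0] := lt_subE td.
have [e e_gt0 eD] : exists2 e, zero < e & e < Order.min D e0.
  by apply: dense; rewrite lt_min D0.
move: eD; rewrite lt_min => /andP[eD ee0].
exists e, t; split=> //; [split=> //; split| exact: ub | exact: lt_le_trans dq].
  move=> f f0; apply: contrapT => nu; have [w we] := sub_ex t f.
  have /lb : forall u, E u -> u <= w.
    move=> u [Au uc]; rewrite leNgt; apply/negP => wu; apply: nu; exists u; split=> //.
    split; first by rewrite -we lt_add2r.
    by apply: le_lt_trans (ub u _) _ => //; rewrite lt_addr.
  by rewrite -we leNgt lt_addr f0.
  move=> u tu ute Au; apply: (nAcd u _ _ Au).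
    rewrite ltNge; apply/negP => uc; have := ub u (conj Au uc).
    by rewrite leNgt tu.
  by apply: (lt_trans ute); rewrite de0 lt_add2l.
Qed.

(** The gap starts for all lengths below [D] are the union of a chain whose members have fewer than
    [N] points, so there are fewer than [N] of them altogether. Two points of [A] have a gap start
    between them, so the number of gap starts below a point is injective on [A] and takes at most
    [N] values. *)
Lemma nwd1_few (A : R -> Prop) D v c d N : Def A -> nwd1 A -> zero < D ->
  v < c -> c < d ->
  (forall e s, zero < e -> e < D -> v < s -> s <= d ->
     (forall k, at_least k (fun t => gap_start A e t /\ s < t /\ c <= t <= d)) \/
     ~ at_least N (fun t => gap_start A e t /\ s < t /\ c <= t <= d)) ->
  ~ at_least N.+1 (fun t => A t /\ c <= t <= d).
Proof.
move=> dA nA D0 vc cd H.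
have [i0 i00 i0D] := dense D0.
pose C (i : {e | zero < e /\ e < D}) t := gap_start A (sval i) t /\ c <= t <= d.
have few_C : ~ at_least N (fun t => exists i, C i t).
  move=> h; have [||[e [e0 eD]] /=] := at_least_chain (exist _ i0 _) _ h; first by [].
    move=> [e [e0 eD]] [f [f0 fD]]; rewrite /C /=.
    wlog ef : e f e0 f0 eD fD / e <= f => [W|].
      case/orP: (le_total e f) => ?; [exact: W|].
      by case: (W f e f0 e0 fD eD) => //; [right|left].
    right=> x [[_ [h1 h2]] cxd]; split=> //; split=> //; split=> // u xu ue.
    by apply: h2 => //; apply: (lt_le_trans ue); rewrite le_add2l.
  apply: (@separated_few _ e v) => //.
  - by rewrite /gap_start; def_auto.
  (* A gap start is adherent to [A], so it cannot fall inside the gap of an earlier one. *)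
  - move=> t u [_ [_ gt]] [_ [gu _]] tu; rewrite leNgt; apply/negP => ue.
    have [f f0 hf] := near_itv tu ue.
    by have [w [Aw /hf[tw we]]] := gu f f0; apply: (gt w).
  - by move=> s; apply: H.
move=> h; apply: few_C; apply: contrapT => /not_at_least_seq[s sN sE].
pose below (p : R) := count (fun t => t < p) s.
have inj_below (p q : R) : A p -> p < q -> c <= p <= d -> c <= q <= d ->
    (below p < below q)%N.
  move=> Ap pq /andP[cp pd] /andP[cq qd].
  have [e [t [eD gt pt tq]]] := gap_start_between dA nA Ap pq D0.
  have ts : t \in s.
    have e0 : zero < e by case: gt.
    apply/sE; exists (exist _ e (conj e0 eD)); split=> //.
    by rewrite (le_trans cp pt) ltW// (lt_le_trans tq).
  pose mid := count (fun x => (p <= x) && (x < q)) s.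
  have -> : below q = (below p + mid)%N.
    rewrite -count_predUI [X in (_ + X)%N](_ : _ = 0%N) ?addn0.
      apply: eq_count => x /=; case: (ltP x p) => //= xp.
      by rewrite (lt_trans xp pq).
    rewrite -[RHS](count_pred0 s); apply: eq_count => x /=.
    by case: (ltP x p).
  by rewrite -addn1 leq_add2l /mid -has_count; apply/hasP; exists t => //; rewrite pt.
have [|x hx h2] := @at_least_map _ _ below _ _ _ h.
  move=> p q [Ap cpd] [Aq cqd] pq.
  case: (ltgtP p q) => // [/(inj_below _ _ Ap)|/(inj_below _ _ Aq)].
    by move=> /(_ cpd cqd); rewrite pq ltnn.
  by move=> /(_ cqd cpd); rewrite pq ltnn.
have := @at_least_card _ _ (fun i : 'I_N => i : nat) N.+1 _ _ (ex_intro2 _ _ x hx h2).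
rewrite card_ord ltnn => H3; suff : false by []; apply: H3 => y [z Az ->].
have cs : (below z < N)%N by apply: leq_ltn_trans sN; exact: count_size.
by exists (Ordinal cs).
Qed.

(** * Uniform local finiteness of nowhere dense families *)

Lemma nbhs_itv (a : R) (A : set R) : nbhs a A ->
  exists c e, [/\ c < a, a < e & forall z, c <= z <= e -> A z].
Proof.
rewrite itv_nbhsE => -[[l u] [/= oi ai] iA].
have [c [ca cl]] : exists c, c < a /\ forall z, c <= z -> (l <= BLeft z)%O.
  case: l oi ai {iA} => [b c|b] oi; rewrite itv_boundlr => /andP[+ _].
    rewrite (itv_open_ends_lside oi) => /dense[c' cc' c'a]; exists c'; split=> // z c'z.
    by rewrite bnd_simp (lt_le_trans cc').
  by have [c ca] := lt_ex a; rewrite (itv_open_ends_linfty oi); exists c.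
have [e [ae eu]] : exists e, a < e /\ forall z, z <= e -> (BRight z <= u)%O.
  case: u oi ai {iA} => [b e|b] oi; rewrite itv_boundlr => /andP[_ +].
    rewrite (itv_open_ends_rside oi) => /dense[e' ae' e'e]; exists e'; split=> // z ze'.
    by rewrite bnd_simp (le_lt_trans ze').
  by have [e ae] := gt_ex a; rewrite (itv_open_ends_rinfty oi); exists e.
exists c, e; split=> // z /andP[cz ze]; apply: iA.
by rewrite /= itv_boundlr cl// eu.
Qed.

Section Families.
Variable V : finType.
Implicit Type X : (V -> R) -> R -> Prop.

Definition rowvec (x : V -> R) : 'rV[R]_#|V| := (\row_i x (enum_val i))%R.

Definition famset X : set 'rV[R]_(#|V| + 1) := [set v |
  X (fun i => v ord0 (lshift 1 (enum_rank i))) (v ord0 (rshift #|V| ord0))].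

Lemma famset_definable X :
  Def (fun p => X p.1 p.2) -> definable S (famset X).
Proof.
move=> dX; apply: (@Def_definable _ (fun x : 'I_(#|V| + 1) -> R =>
  X (fun i => x (lshift 1 (enum_rank i))) (x (rshift #|V| ord0)))).
by def_auto.
Qed.

Lemma slice_famset X x : slice (famset X) (rowvec x) = X x.
Proof.
apply/funext => t; rewrite /slice /famset /=.
congr (X _ _); last by rewrite row_mxEr mxE.
by apply/funext => i; rewrite row_mxEl mxE enum_rankK.
Qed.

Lemma uniformly_finite_at_least X a I U : uniformly_finite_near (famset X) a I U ->
  exists N, forall x, U (rowvec x) -> forall c e, c < a -> a < e ->
  (forall z, c <= z <= e -> I z) ->
  (forall k, at_least k (fun t => X x t /\ c <= t <= e)) \/
  ~ at_least N (fun t => X x t /\ c <= t <= e).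
Proof.
move=> [N _ H]; exists N.+1 => x Ux c e ca ae ceI.
have [||z Jz|inf|few] := H _ Ux `[c, e]%classic; first by exists c, e.
- rewrite /interior /=; apply: (filterS (P := `]c, e[%classic)).
    by apply: subset_itvW.
  by apply: open_nbhs_nbhs; split; [exact: itv_open|rewrite /= in_itv /= ca].
- by apply: ceI; move/interior_subset: Jz; rewrite /= in_itv.
- rewrite slice_famset in inf; left => k; apply: at_least_sub (infinite_at_least k inf).
  by move=> t [Xt]; rewrite /= in_itv.
rewrite slice_famset in few; right=> h; apply: (card_le_not_at_least few).
by apply: at_least_sub h => t [Xt cte]; split=> //; rewrite /= in_itv.
Qed.

End Families.

(** The gap length (index [None]) and the cut (index [Some None]) are made parameters, so that
    uniform finiteness gives one [N] for all lengths and all final segments. *)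
Definition gap_family (V : finType) (X : (V -> R) -> R -> Prop)
    (w : option (option V) -> R) (t : R) : Prop :=
  gap_start (X (fun i => w (Some (Some i)))) (w None) t /\ w (Some None) < t.

Definition add_params (V : Type) (x : V -> R) (e s : R) (o : option (option V)) : R :=
  match o with Some (Some i) => x i | Some None => s | None => e end.

Lemma gap_family_definable (V : finType) (X : (V -> R) -> R -> Prop) :
  Def (fun p => X p.1 p.2) -> Def (fun p => gap_family X p.1 p.2).
Proof. move=> dX; rewrite /gap_family /gap_start; def_auto. Qed.

Lemma nwd1_few_family (V : finType) (X : (V -> R) -> R -> Prop) a I U :
  Def (fun p => X p.1 p.2) ->
  uniformly_finite_near (famset (gap_family X)) a I U ->
  exists N, forall x v D c e, nwd1 (X x) -> zero < D -> v < c -> c < a -> a < e ->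
  (forall z, c <= z <= e -> I z) ->
  (forall f s, zero < f -> f < D -> v < s -> s <= e -> U (rowvec (add_params x f s))) ->
  ~ at_least N (fun t => X x t /\ c <= t <= e).
Proof.
move=> dX /uniformly_finite_at_least[N H]; exists N.+1 => x v D c e nX D0 vc ca ae ceI HU.
apply: (@nwd1_few _ D v) => //; [by def_auto|exact: lt_trans ae|].
move=> f s f0 fD vs se.
have [h|h] := H _ (HU f s f0 fD vs se) c e ca ae ceI; [left=> k|right=> h'].
  by apply: at_least_sub (h k) => t [[]].
by apply: h; apply: at_least_sub h' => t [? []].
Qed.

Lemma few_near (HL2 : LUF2 S) (V : finType) (X : (V -> R) -> R -> Prop) a b :
  Def (fun p => X p.1 p.2) -> exists c e D N, [/\ c < a, a < e, zero < D &
    forall x, ball [set: V]%SET D b x -> nwd1 (X x) ->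
      ~ at_least N (fun t => X x t /\ c <= t <= e)].
Proof.
move=> dX.
(* The base point has gap length zero and cut [a]: the box around it contains all small positive
   lengths. *)
have [I [U [_ Ia oU Ub uf]]] :=
  HL2 _ _ (famset_definable (gap_family_definable dX)) a (rowvec (add_params b zero a)).
have [N H] := nwd1_few_family dX uf.
have [c0 [e0 [c0a ae0 ceI]]] := nbhs_itv Ia.
have [D D0 hD] : exists2 D, zero < D &
    forall y, ball [set: option (option V)]%SET D (add_params b zero a) y -> U (rowvec y).
  case: oU Ub => p [q ->] /= Ub.
  have [i|D D0 hD] := @fin_eps (option (option V)) (fun i f => forall t,
      near f (add_params b zero a i) t ->
      p ord0 (enum_rank i) < t < q ord0 (enum_rank i)).
    have := Ub (enum_rank i); rewrite mxE enum_rankK => /andP[pi iq].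
    have [f f0 hf] := near_itv pi iq; exists f => // g g0 gf t /(near_le gf)/hf[-> ->].
    by [].
  exists D => // y hy i; rewrite mxE.
  have := hD (enum_val i) D D0 (lexx _) (y (enum_val i)); rewrite enum_valK; apply.
  by apply: hy; rewrite inE.
(* Cuts are parameters too: those in [(v, e]] must stay within [D] of [a], which limits the
   interval. *)
have [l [u [la ua lu]]] := nearE D a.
have al : l < a by rewrite -la lt_addr.
have au : a < u by rewrite ua lt_addr.
have [v lv va] := dense al.
have [c] : exists2 c, Order.max v c0 < c & c < a by apply: dense; rewrite gt_max va.
rewrite gt_max => /andP[vc c0c] ca.
have [e ae] : exists2 e, a < e & e < Order.min u e0 by apply: dense; rewrite lt_min au.
rewrite lt_min => /andP[eu ee0].
exists c, e, D, N; split=> // x bx nX.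
apply: (H x v D) => // [z /andP[cz ze]|f s f0 fD vs se].
  by apply: ceI; rewrite (ltW (lt_le_trans c0c cz)) (ltW (le_lt_trans ze ee0)).
apply: hD => -[[i|]|] _ /=.
- by apply: bx; rewrite inE.
- by apply/lu; split; [apply: lt_trans vs|apply: le_lt_trans eu].
- by split; [rewrite (lt_trans f0)// lt_addr|rewrite add0].
Qed.

Lemma few_near_all (HL1 : LUF1 S) (V : finType) (X : (V -> R) -> R -> Prop) a :
  Def (fun p => X p.1 p.2) -> (forall x, nwd1 (X x)) ->
  exists c e N, [/\ c < a, a < e & forall x, ~ at_least N (fun t => X x t /\ c <= t <= e)].
Proof.
move=> dX nX.
have [I [_ Ia uf]] := HL1.2 _ _ (famset_definable (gap_family_definable dX)) a.
have [N H] := nwd1_few_family dX uf.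
have [c [e [ca ae ceI]]] := nbhs_itv Ia.
exists c, e, N; split=> // x; have [v vc] := lt_ex c; have [D D0] := pos_ex.
exact: (H x v D).
Qed.

Lemma few_on_itv (HS : SLUF S) a : exists c e, [/\ c < a, a < e &
  forall (V : finType) (X : (V -> R) -> R -> Prop),
  Def (fun p => X p.1 p.2) -> (forall x, nwd1 (X x)) ->
  exists N, forall x, ~ at_least N (fun t => X x t /\ c <= t <= e)].
Proof.
have [I [_ Ia uf]] := HS.2 a.
have [c [e [ca ae ceI]]] := nbhs_itv Ia.
exists c, e; split=> // V X dX nX.
have [N H] := nwd1_few_family dX (uf _ _ (famset_definable (gap_family_definable dX))).
exists N => x; have [v vc] := lt_ex c; have [D D0] := pos_ex.
exact: (H x v D).
Qed.

(** * Chains of nowhere dense subsets of the line *)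

Section SecondKind.
Hypothesis S_LUF2 : LUF2 S.

Definition chain (I T : Type) (A : I -> T -> Prop) : Prop :=
  forall i j, (forall x, A i x -> A j x) \/ (forall x, A j x -> A i x).

Lemma chain_homo (T : Type) (A : R -> T -> Prop) :
  (forall i j x, i <= j -> A i x -> A j x) -> chain A.
Proof.
by move=> h i j; case/orP: (le_total i j) => ij; [left|right] => x; apply: h.
Qed.

Lemma chain_anti_pos (T : Type) (A : R -> T -> Prop) :
  (forall i x, A i x -> zero < i) ->
  (forall i j x, zero < i -> i <= j -> A j x -> A i x) -> chain A.
Proof.
move=> pos h i j; have [i0|ni] := pselect (zero < i); last by left=> x /pos.
have [j0|nj] := pselect (zero < j); last by right=> x /pos.
by case/orP: (le_total i j) => ij; [right|left] => x; apply: h.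
Qed.

(** Compactness of [[p, q]] along a definable chain. The point [w] is the supremum of the lower
    bounds of members on [[p, q]]: if a member missed the points within [e] of [w], a member
    contained in it and bounded below by more than [w - e] would be bounded below by [w + e]. *)
Lemma chain_compact (D : R -> Prop) (W : R -> R -> Prop) p q :
  Def D -> Def (fun x => W x.1 x.2) -> (exists i, D i) ->
  (forall i j, D i -> D j ->
    (forall x, W i x -> W j x) \/ (forall x, W j x -> W i x)) ->
  (forall i, D i -> exists2 u, W i u & p <= u <= q) ->
  exists2 w, p <= w <= q &
    forall i e, D i -> zero < e -> exists2 u, W i u & near e w u.
Proof.
move=> dD dW [i0 Di0] ch ne.
pose G w := w <= q /\ exists i, D i /\ forall u, W i u -> p <= u <= q -> w <= u.
have dG : Def G by rewrite /G; def_auto.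
have pq : p <= q by have [u _ /andP[pu]] := ne _ Di0; apply: le_trans.
have Gp : G p by split=> //; exists i0; split=> // u _ /andP[].
have [w [ub lb]] := sup_ex dG (ex_intro _ _ Gp) (ex_intro _ q (fun x (Gx : G x) => Gx.1)).
have wq : w <= q by apply: lb => x [].
exists w; first by rewrite ub.
move=> i e Di e0; apply: contrapT => nu.
have [c ce] := sub_ex w e.
have [g Gg cg] : exists2 g, G g & c < g.
  apply: contrapT => ng; have /lb : forall x, G x -> x <= c.
    by move=> x Gx; rewrite leNgt; apply/negP => cx; apply: ng; exists x.
  by rewrite -ce leNgt lt_addr e0.
case: Gg => gq [i' [Di' gi']].
have [k [Dk ki ki']] : exists k, [/\ D k, forall x, W k x -> W i x &
    forall x, W k x -> W i' x].
  by case: (ch i i' Di Di') => h; [exists i|exists i'].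
have low u : W k u -> p <= u <= q -> w + e <= u.
  move=> Wu pq_u; rewrite leNgt; apply/negP => uwe; apply: nu; exists u; first exact: ki.
  split=> //; rewrite -ce lt_add2r; apply: (lt_le_trans cg); apply: gi' => //.
  exact: ki'.
have : G (w + e).
  split; last by exists k.
  by have [u Wu pq_u] := ne _ Dk; apply: (le_trans (low _ Wu pq_u)); case/andP: pq_u.
by move/ub; rewrite leNgt lt_addr e0.
Qed.

Lemma not_nwd1 (A : R -> Prop) : ~ nwd1 A -> exists c e, c < e /\
  forall c' e', c <= c' -> c' < e' -> e' <= e -> exists y, [/\ A y, c' < y & y < e'].
Proof.
move=> nA; apply: contrapT => h; apply: nA => c e ce; apply: contrapT => h'.
apply: h; exists c, e; split=> // c' e' cc' ce' ee'; apply: contrapT => h''.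
apply: h'; exists c', e'; split=> // y cy ye Ay; apply: h''; by exists y.
Qed.

Lemma dense_at_least (A : R -> Prop) c e k : c < e ->
  (forall c' e', c <= c' -> c' < e' -> e' <= e -> exists y, [/\ A y, c' < y & y < e']) ->
  at_least k (fun t => A t /\ c <= t <= e).
Proof.
elim: k e => [//|k IH] e ce h.
have [y [Ay cy ye]] := h c e (lexx _) ce (lexx _).
exists y; first by rewrite (ltW cy) (ltW ye).
have [z cz zy] := dense cy.
apply: at_least_sub (IH z cz _) => [t [At /andP[ct tz]]|c' e' h1 h2 h3].
  have ty := le_lt_trans tz zy; split; last by move=> E; rewrite E ltxx in ty.
  by rewrite ct (ltW (lt_trans ty ye)).
by apply: h => //; apply: (le_trans h3); apply/ltW/(lt_trans zy).
Qed.

Lemma nwd1_sub (A B : R -> Prop) : (forall x, A x -> B x) -> nwd1 B -> nwd1 A.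
Proof.
move=> AB nB c e /nB[c' [e' [h1 h2 h3 h4]]]; exists c', e'; split=> // y cy ye /AB.
exact: h4.
Qed.

Definition net (c d e : R) (A : R -> Prop) : Prop :=
  forall w, c <= w -> w <= d -> exists z, A z /\ near e w z.

Lemma near_interval_meet c d e w : zero < e -> c < d -> c <= w -> w <= d ->
  exists c' d', [/\ c <= c', c' < d', d' <= d &
    forall z, c' < z -> z < d' -> near e w z].
Proof.
move=> e0 cd cw wd; have [l [u [lw uw lu]]] := nearE e w.
exists (Order.max c l), (Order.min d u).
rewrite le_max lexx ge_min lexx gt_max !lt_min cd; split=> //.
  have lw' : l < w by rewrite -lw lt_addr.
  have wu : w < u by rewrite uw lt_addr.
  by rewrite (le_lt_trans cw wu) (lt_le_trans lw' wd) (lt_trans lw' wu).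
by move=> z; rewrite gt_max lt_min => /andP[_ lz] /andP[_ zu]; apply/lu.
Qed.

(* If the union were dense in an interval, the unions of those members that are
   not [e]-nets would be nowhere dense, hence locally finite with a bound
   uniform as [e] tends to 0; but they exhaust the whole union. *)
Lemma nwd1_chain (A : R -> R -> Prop) : Def (fun x => A x.1 x.2) -> chain A ->
  (forall i, nwd1 (A i)) -> nwd1 (fun z => exists i, A i z).
Proof.
move=> dA ch nA; apply: contrapT => /not_nwd1[c [d [cd dense_cd]]].
pose X (x : 'I_1 -> R) z := zero < x ord0 /\
  exists i, A i z /\ ~ net c d (x ord0) (A i).
have dX : Def (fun p => X p.1 p.2) by rewrite /X /net; def_auto.
have nX x : nwd1 (X x).
  have [x0|nx0] := pselect (zero < x ord0); last first.
    by move=> p q pq; exists p, q; split=> // y _ _ [].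
  (* Otherwise the sets of points of [[c, d]] far from [A i] form a chain of nonempty sets; a point
     adherent to all of them has no point of the union nearby, against density. *)
  have [i neti] : exists i, net c d (x ord0) (A i).
    apply: contrapT => nnet.
    pose W i w := forall z, A i z -> ~ near (x ord0) w z.
    have [|||||w /andP[cw wd] hw] := @chain_compact (fun=> True) W c d.
    - by rewrite /W; def_auto.
    - by rewrite /W; def_auto.
    - by exists zero.
    - by move=> i j _ _; case: (ch i j) => h; [right|left] => w Ww z /h/Ww.
    - move=> i _; apply: contrapT => nW; apply: nnet; exists i => w cw wd.
      apply: contrapT => nz; apply: nW; exists w; last by rewrite cw.
      by move=> z Az nwz; apply: nz; exists z.
    have [c' [d' [h1 h2 h3 h4]]] := near_interval_meet x0 cd cw wd.
    have [z [[i Aiz] c'z zd']] := dense_cd _ _ h1 h2 h3.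
    have [f f0 hf] := near_open (nearC (h4 z c'z zd')).
    have [u Wu wu] := hw i f I f0.
    exact: (Wu z Aiz (nearC (hf u wu))).
  (* A member that is not a net cannot contain the net [A i], so it is contained in [A i]. *)
  apply: nwd1_sub (nA i) => z [_ [j [Ajz nj]]].
  case: (ch i j) => h; last exact: h.
  by exfalso; apply: nj => w cw wd; have [y [/h Ay wy]] := neti w cw wd; exists y.
have [a ca ad] := dense cd.
have [c1 [d1 [D [N [c1a ad1 D0 few]]]]] := few_near S_LUF2 a (fun=> zero) dX.
pose c2 := Order.max c c1; pose d2 := Order.min d d1.
have cd2 : c2 < d2.
  by rewrite gt_max !lt_min cd (lt_trans ca) // (lt_trans c1a) // (lt_trans c1a).
have [D' D'0 D'D] := dense D0.
pose F (e : {e | zero < e /\ e < D}) t := X (fun=> sval e) t /\ c1 <= t <= d1.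
have : at_least N (fun t => exists i, F i t).
  apply: at_least_sub (@dense_at_least (fun z => exists i, A i z) c2 d2 N cd2 _).
    move=> t [[i Ait]]; rewrite ge_max le_min => /andP[/andP[_ ct] /andP[_ td]].
    (* A hole of [A i] has a point [w] at distance at least some [e] from [A i], so [A i] is no net
       for small lengths. *)
    have [c' [d' [h1 h2 h3 h4]]] := nA i _ _ cd.
    have [w c'w wd'] := dense h2.
    have [e e0 he] := near_itv c'w wd'.
    have eD : Order.min e D' < D by rewrite gt_min D'D orbT.
    have e'0 : zero < Order.min e D' by rewrite lt_min e0.
    exists (exist (fun e => zero < e /\ e < D) _ (conj e'0 eD)); split; last by rewrite ct.
    split=> //; exists i; split=> //= /(_ w (le_trans h1 (ltW c'w)) (le_trans (ltW wd') h3)).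
    move=> [z [Az nz]]; have [|cz zd] := he z; last exact: (h4 z).
    by apply: near_le nz; rewrite ge_min lexx.
  move=> c' e' h1 h2 h3; apply: dense_cd => //.
    by apply: le_trans h1; rewrite le_max lexx.
  by apply: (le_trans h3); rewrite ge_min lexx.
pose i0 := exist (fun e => zero < e /\ e < D) _ (conj D'0 D'D).
move=> /(at_least_chain i0)[|[e [e0 eD]] h].
  move=> [e [e0 eD]] [f [f0 fD]]; rewrite /F /X /=.
  wlog ef : e f e0 f0 eD fD / e <= f => [Wl|].
    case/orP: (le_total e f) => ?; [exact: Wl|].
    by case: (Wl f e f0 e0 fD eD) => //; [right|left].
  right=> x [[_ [i [Ai ni]]] cxd]; split=> //; split=> //; exists i; split=> // ne.
  apply: ni => w cw wd; have [z [Az nz]] := ne w cw wd; exists z; split=> //.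
  exact: near_le nz.
apply: (few (fun=> e) _ (nX _)) => // i _.
by rewrite /near add0 eD (lt_trans e0) ?lt_addr.
Qed.

(** * Nowhere dense sets in several variables *)

Section Sets.
Variable V : finType.
Implicit Types (x y z : V -> R) (A B F K : (V -> R) -> Prop) (I J : {set V}).

Definition nwd I A : Prop := forall x e, zero < e -> exists x' e',
  zero < e' /\ ball I e x x' /\ forall y, ball I e' x' y -> ~ A y.

Definition dense_in I A x e : Prop := forall x' f, zero < f -> ball I e x x' ->
  exists y, A y /\ ball I f x' y.

Definition closed_set A : Prop :=
  forall x, (forall e, zero < e -> exists y, A y /\ ball [set: V]%SET e x y) -> A x.

Definition fat I A : Prop :=
  exists x e, zero < e /\ forall y, ball I e x y -> A y.

Definition cylin I A : Prop :=
  forall x y, (forall i, i \in I -> x i = y i) -> A x -> A y.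

Definition mix I x y : V -> R := fun i => if i \in I then x i else y i.

Lemma mix_in I x y i : i \in I -> mix I x y i = x i.
Proof. by rewrite /mix => ->. Qed.

Lemma mix_notin I x y i : i \notin I -> mix I x y i = y i.
Proof. by rewrite /mix => /negbTE ->. Qed.

Lemma not_nwd I A : ~ nwd I A -> exists x e, zero < e /\ dense_in I A x e.
Proof.
move=> nA; apply: contrapT => h; apply: nA => x e e0; apply: contrapT => h'.
apply: h; exists x, e; split=> // x' f f0 xx'; apply: contrapT => ny.
apply: h'; exists x', f; split=> //; split=> // y x'y Ay; apply: ny; by exists y.
Qed.

Lemma dense_not_nwd I A x e : zero < e -> dense_in I A x e -> ~ nwd I A.
Proof.
move=> e0 dA /(_ x e e0)[x' [f [f0 [xx' nA]]]].
by have [y [Ay x'y]] := dA x' f f0 xx'; apply: (nA y).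
Qed.

Lemma fat_not_nwd I A : fat I A -> ~ nwd I A.
Proof.
move=> [x [e [e0 h]]]; apply: (@dense_not_nwd _ _ x e) => // x' f f0 xx'.
by exists x'; split; [exact: h|exact: ball_refl].
Qed.

Lemma nwd_sub I A B : (forall x, A x -> B x) -> nwd I B -> nwd I A.
Proof.
move=> AB nB x e e0; have [x' [f [f0 [xx' h]]]] := nB x e e0.
by exists x', f; split=> //; split=> // y /h nBy /AB.
Qed.

Lemma nwd_shrink I A x e : nwd I A -> zero < e -> exists x' e',
  zero < e' /\ forall y, ball I e' x' y -> ball I e x y /\ ~ A y.
Proof.
move=> nA e0; have [x' [f [f0 [xx' h]]]] := nA x e e0.
have [g g0 hg] := ball_open xx'; exists x', (Order.min f g).
rewrite lt_min f0 g0; split=> // y yb; split.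
  by apply: hg; apply: ball_le yb; rewrite ge_min lexx orbT.
by apply: h; apply: ball_le yb; rewrite ge_min lexx.
Qed.

Lemma nwd_union I A B : nwd I A -> nwd I B -> nwd I (fun x => A x \/ B x).
Proof.
move=> nA nB x e e0; have [x' [f [f0 h]]] := nwd_shrink x nA e0.
have [y [g [g0 h']]] := nwd_shrink x' nB f0.
exists y, g; split=> //; split.
  by case: (h y) => //; case: (h' y) => //; exact: ball_refl.
by move=> z /h'[/h[_ nAz] nBz] [].
Qed.

Lemma nwd_fin (T : finType) I (A : T -> (V -> R) -> Prop) :
  (forall j, nwd I (A j)) -> nwd I (fun x => exists j, A j x).
Proof.
move=> nA; suff h (r : seq T) : nwd I (fun x => exists2 j, j \in r & A j x).
  by apply: nwd_sub (h (enum T)) => x [j Aj]; exists j; rewrite ?mem_enum.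
elim: r => [|j r IH]; first by move=> x e e0; exists x, e; split=> //; split;
  [exact: ball_refl|move=> y _ []].
apply: nwd_sub (nwd_union (nA j) IH) => x [k].
by rewrite inE => /orP[/eqP->|kr] Ak; [left|right; exists k].
Qed.

Lemma closed_cylin I A x : closed_set A -> cylin I A ->
  (forall e, zero < e -> exists y, A y /\ ball I e x y) -> A x.
Proof.
move=> cA iA h; apply: cA => e e0; have [y [Ay xy]] := h e e0.
exists (mix I y x); split; first by apply: iA Ay => i iI; rewrite mix_in.
move=> i _; rewrite /mix; case: ifP => iI; [exact: xy|exact: near_refl].
Qed.

Lemma closed_dense I A x e : closed_set A -> cylin I A -> dense_in I A x e ->
  forall y, ball I e x y -> A y.
Proof. by move=> cA iA dA y xy; apply: (closed_cylin cA iA) => f f0; apply: dA. Qed.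

Lemma closed_fat_or_nwd I A : closed_set A -> cylin I A -> fat I A \/ nwd I A.
Proof.
move=> cA iA; have [|/not_nwd[x [e [e0 dA]]]] := pselect (nwd I A); first by right.
by left; exists x, e; split=> //; apply: closed_dense dA.
Qed.

Lemma ball_upd2 I e j x y s t : near e s t -> ball I e x y ->
  ball (j |: I) e (upd x j s) (upd y j t).
Proof.
move=> st xy i; rewrite /upd !inE; case: eqP => [->//|_] /=; exact: xy.
Qed.

(** The definable Baire property of [R^I], stated with cylinders so that it can serve as induction
    hypothesis on [I] inside the fixed power [R^V]. *)
Definition baire I : Prop := forall A : R -> (V -> R) -> Prop,
  Def (fun p => A p.1 p.2) -> chain A -> (forall t, cylin I (A t)) ->
  (forall t, nwd I (A t)) -> nwd I (fun x => exists t, A t x).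

Lemma upd_agree I j x y t : (forall i, i \in I -> x i = y i) ->
  forall i, i \in j |: I -> upd x j t i = upd y j t i.
Proof. by move=> xy i; rewrite /upd !inE; case: eqP => //= _ /xy. Qed.

Lemma chain_cut (A : R -> (V -> R) -> Prop) t0 : chain A ->
  chain (fun t x => t < t0 /\ A t x).
Proof.
move=> ch t u; have [tt|nt] := pselect (t < t0); last by left=> x [].
have [uu|nu] := pselect (u < t0); last by right=> x [].
by case: (ch t u) => h; [left|right] => x [_ /h].
Qed.

(* If the fibres contain intervals of length [s] over a somewhere dense set,
   take the infimum [t0] of the levels [t] such that those with left endpoint at
   most [t] do so: near some point all of them contain [t1, t0 + s]. *)
Lemma fiber_nwd I j F p q : baire I -> j \notin I -> Def F -> closed_set F ->
  cylin (j |: I) F -> (forall x, F x -> p <= x j <= q) -> nwd (j |: I) F ->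
  nwd I (fun x => ~ nwd1 (fun t => F (upd x j t))).
Proof.
move=> bI jI dF cF iF Fpq nF.
pose P s x := zero < s /\ exists c, forall w, c <= w -> w <= c + s -> F (upd x j w).
apply: (@nwd_sub _ _ (fun x => exists s, P s x)).
  move=> x /not_nwd1[c [d [cd h]]].
  have [c' cc' c'd] := dense cd; have [d' c'd' d'd] := dense c'd.
  have [s s0 d'E] := lt_subE c'd'.
  exists s; split=> //; exists c' => w; rewrite -d'E => c'w wd'.
  apply: (closed_cylin cF iF) => e e0.
  have [a [b [h1 h2 h3 h4]]] := near_interval_meet e0 c'd' c'w wd'.
  have [y [Fy ay yb]] := h a b (le_trans (ltW cc') h1) h2 (le_trans h3 (ltW d'd)).
  exists (upd x j y); split=> //; apply: ball_upd2; first exact: h4.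
  exact: ball_refl.
have iP s : cylin I (P s).
  move=> x y xy [s0 [c h]]; split=> //; exists c => w h1 h2.
  by apply: iF (h w h1 h2); apply: upd_agree.
apply: (bI) => //.
- by rewrite /P; def_auto.
- apply: chain_anti_pos => [s x []//|s t x s0 st [t0 [c h]]]; split=> //; exists c.
  by move=> w cw ws; apply: h => //; apply: (le_trans ws); rewrite le_add2l.
(* The lengths index a chain, so by the Baire property a single length [s] can be fixed. *)
move=> s; apply: contrapT => nP.
pose Q t x := zero < s /\ exists c, c <= t /\ forall w, c <= w -> w <= c + s -> F (upd x j w).
have dQ : Def (fun x : R * (V -> R) => Q x.1 x.2) by rewrite /Q; def_auto.
have iQ t : cylin I (Q t).
  move=> x y xy [s0 [c [ct h]]]; split=> //; exists c; split=> // w h1 h2.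
  by apply: iF (h w h1 h2); apply: upd_agree.
have Qq : ~ nwd I (Q q).
  move=> h; apply: nP; apply: nwd_sub h => x [s0 [c h]]; split=> //; exists c; split=> //.
  have /Fpq : F (upd x j c) by apply: h; rewrite // le_addr ltW.
  by rewrite upd_same => /andP[].
have Qp t : ~ nwd I (Q t) -> p <= t.
  move=> nQ; rewrite leNgt; apply/negP => tp; apply: nQ => x e e0; exists x, e.
  split=> //; split; [exact: ball_refl|move=> y _ [s0 [c [ct h]]]].
  have /Fpq : F (upd y j c) by apply: h; rewrite // le_addr ltW.
  by rewrite upd_same => /andP[pc _]; move: (le_lt_trans (le_trans pc ct) tp); rewrite ltxx.
have dD : Def (fun t => ~ nwd I (Q t)).
  by rewrite /nwd; def_auto.
have [t0 [lb gb]] := inf_ex dD (ex_intro _ q Qq) (ex_intro _ p Qp).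
have s0 : zero < s by apply: contrapT => ns; apply: Qq => x e e0; exists x, e;
  split=> //; split; [exact: ball_refl|move=> y _ []].
have [t1 nQ1 t1s] : exists2 t1, ~ nwd I (Q t1) & t1 < t0 + s.
  apply: contrapT => nt; have /gb : forall t, ~ nwd I (Q t) -> t0 + s <= t.
    by move=> t nQt; rewrite leNgt; apply/negP => ts; apply: nt; exists t.
  by rewrite leNgt lt_addr s0.
have t01 : t0 <= t1 by apply: lb.
(* Each level below [t0] gives a nowhere dense set, hence so does their union by the Baire property
   of [R^I]; a smaller box avoids it. *)
have nlow : nwd I (fun x => exists t, t < t0 /\ Q t x).
  apply: (bI).
  - by def_auto.
  - apply: chain_cut; apply: chain_homo => t u x tu [_ [c [ct h]]]; split=> //.
    by exists c; split=> //; apply: le_trans tu.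
  - by move=> t x y xy [tt /(iQ _ _ _ xy)].
  - move=> t; have [tt|nt] := pselect (t < t0); last first.
      by move=> x e e0; exists x, e; split=> //; split; [exact: ball_refl|move=> y _ []].
    apply: (@nwd_sub _ _ (Q t)) => [x []//|]; apply: contrapT => /lb.
    by rewrite leNgt tt.
have [x0 [e0 [e00 dQ1]]] := not_nwd nQ1.
have [x1 [e1 [e10 h1]]] := nwd_shrink x0 nlow e00.
(* The intervals found over a dense set of points start between [t0] and [t1], hence contain
   [[t1, t0 + s]]; closedness of [F] extends this to the whole box. *)
have full x w : ball I e1 x1 x -> t1 <= w -> w <= t0 + s -> F (upd x j w).
  move=> xx1 t1w ws; apply: (closed_cylin cF iF) => f f0.
  have [f1 f10 hf1] := ball_open xx1.
  have fg0 : zero < Order.min f f1 by rewrite lt_min f0.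
  have [y [Qy xy]] := dQ1 x _ fg0 (h1 x xx1).1.
  exists (upd y j w); split; last first.
    apply: ball_upd2; first exact: near_refl.
    by apply: ball_le xy; rewrite ge_min lexx.
  have x1y : ball I e1 x1 y by apply: hf1; apply: ball_le xy; rewrite ge_min lexx orbT.
  case: (Qy) => _ [c [ct h]]; apply: (h); first exact: le_trans t1w.
  apply: (le_trans ws); rewrite le_add2r leNgt; apply/negP => cs.
  by apply: (h1 y x1y).2; exists c; split=> //; split=> //; exists c.
have [w t1w ws] := dense t1s.
have [e e_gt0 he] := near_itv t1w ws.
apply: (@fat_not_nwd (j |: I) F) => //.
exists (upd x1 j w), (Order.min e e1); rewrite lt_min e_gt0 e10; split=> // y /ballU1[].
rewrite upd_same => wy xy; rewrite -(upd_id y j).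
have [|t1y ys] := he (y j); first by apply: near_le wy; rewrite ge_min lexx.
apply: full; [|exact: ltW|exact: ltW] => i iI.
have ij : i != j by apply: contraNneq jI => <-.
by have := xy i iI; rewrite upd_neq //; apply: near_le; rewrite ge_min lexx orbT.
Qed.

End Sets.

(** * D-sigma sets *)

Definition bounded_set (V : finType) (A : (V -> R) -> Prop) : Prop :=
  exists p q, forall x, A x -> forall i, p <= x i <= q.

Definition open_set (V : finType) (U : (V -> R) -> Prop) : Prop :=
  forall x, U x -> exists s, zero < s /\ forall y, ball [set: V]%SET s x y -> U y.

(* The D-sigma sets of Dolich, Miller and Steinhorn. They are usually unions of
   families of compact sets with two parameters; iterating unions of chains
   with one parameter allows structural induction instead. *)
Inductive Sig (V : finType) : ((V -> R) -> Prop) -> Prop :=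
| Sig_compact K : Def K -> closed_set K -> bounded_set K -> Sig K
| Sig_union (A : R -> (V -> R) -> Prop) : Def (fun p => A p.1 p.2) ->
    chain A -> (forall t, Sig (A t)) -> Sig (fun x => exists t, A t x).

Section SigmaSets.
Variable V : finType.
Implicit Types (x y z : V -> R) (A B F K U : (V -> R) -> Prop) (I J : {set V}).

Lemma Sig_ext A B : (forall x, A x <-> B x) -> Sig A -> Sig B.
Proof. by move=> AB; rewrite (_ : A = B) //; apply/funext => x; apply/propext. Qed.

Lemma Sig_Def A : Sig A -> Def A.
Proof. by case=> // {}A dA _ _; def_auto. Qed.

Lemma closed_and A B : closed_set A -> closed_set B ->
  closed_set (fun x => A x /\ B x).
Proof.
move=> cA cB x h; split; [apply: cA => e /h[y [[Ay _] xy]]|apply: cB => e /h[y [[_ By] xy]]];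
  by exists y.
Qed.

Lemma closed_or A B : closed_set A -> closed_set B ->
  closed_set (fun x => A x \/ B x).
Proof.
move=> cA cB x h; have [|nA] := pselect (A x); [by left|right].
apply: cB => e e0; apply: contrapT => nB; apply: nA; apply: cA => f f0.
have [|y [[Ay|By] xy]] := h (Order.min e f); first by rewrite lt_min e0.
  by exists y; split=> //; apply: ball_le xy; rewrite ge_min lexx orbT.
by exfalso; apply: nB; exists y; split=> //; apply: ball_le xy; rewrite ge_min lexx.
Qed.

Lemma Sig_and A B : Sig A -> Sig B -> Sig (fun x => A x /\ B x).
Proof.
elim=> {A} [K dK cK bK|A dA chA sA IHA] sB.
  elim: sB => {B} [K' dK' cK' bK'|B dB chB sB IHB].
    apply: Sig_compact; [by def_auto|exact: closed_and|].
    by have [p [q h]] := bK; exists p, q => x [/h].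
  apply: (@Sig_ext (fun x => exists t, K x /\ B t x)).
    by move=> x; split=> [[t [Kx Bx]]|[Kx [t Bx]]]; [split=> //|]; exists t.
  apply: Sig_union => //; first by def_auto.
  by move=> s t; case: (chB s t) => h; [left|right] => x [Kx /h].
apply: (@Sig_ext (fun x => exists t, A t x /\ B x)).
  by move=> x; split=> [[t [Ax Bx]]|[[t Ax] Bx]]; [split=> //|]; exists t.
have dB := Sig_Def sB.
apply: Sig_union; [by def_auto| |by move=> t; exact: IHA].
by move=> s t; case: (chA s t) => h; [left|right] => x [/h].
Qed.

Lemma Sig_or A B : Sig A -> Sig B -> Sig (fun x => A x \/ B x).
Proof.
elim=> {A} [K dK cK bK|A dA chA sA IHA] sB.
  elim: sB => {B} [K' dK' cK' bK'|B dB chB sB IHB].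
    apply: Sig_compact; [by def_auto|exact: closed_or|].
    have [p [q h]] := bK; have [p' [q' h']] := bK'.
    exists (Order.min p p'), (Order.max q q') => x hx i; rewrite ge_min le_max.
    by case: hx => [/h|/h'] /(_ i)/andP[-> ->]; rewrite ?orbT.
  apply: (@Sig_ext (fun x => exists t, K x \/ B t x)).
    move=> x; split=> [[t [Kx|Bx]]|[Kx|[t Bx]]]; [by left|by right; exists t| |].
      by exists zero; left.
    by exists t; right.
  apply: Sig_union => //; first by def_auto.
  by move=> s t; case: (chB s t) => h; [left|right] => x [Kx|/h]; by [left|right].
apply: (@Sig_ext (fun x => exists t, A t x \/ B x)).
  move=> x; split=> [[t [Ax|Bx]]|[[t Ax]|Bx]]; [by left; exists t|by right| |].
    by exists t; left.
  by exists zero; right.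
have dB := Sig_Def sB.
apply: Sig_union; [by def_auto| |by move=> t; exact: IHA].
by move=> s t; case: (chA s t) => h; [left|right] => x [/h|Bx]; by [left|right].
Qed.

Lemma fin_ub (g : V -> R) : exists r, forall i, g i <= r.
Proof.
suff [r h] : exists r, forall i, i \in enum V -> g i <= r.
  by exists r => i; apply: h; rewrite mem_enum.
elim: (enum V) => [|j s [r h]]; first by exists zero.
exists (Order.max r (g j)) => i; rewrite inE le_max => /orP[/eqP->|/h->//].
by rewrite lexx orbT.
Qed.

Lemma fin_lb (g : V -> R) : exists r, forall i, r <= g i.
Proof.
suff [r h] : exists r, forall i, i \in enum V -> r <= g i.
  by exists r => i; apply: h; rewrite mem_enum.
elim: (enum V) => [|j s [r h]]; first by exists zero.
exists (Order.min r (g j)) => i; rewrite inE ge_min => /orP[/eqP->|/h->//].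
by rewrite lexx orbT.
Qed.

Lemma closed_lb_add (t u : R) j :
  closed_set (fun x : V -> R => t <= x j + u).
Proof.
move=> x h; rewrite leNgt; apply/negP => /lt_subE[f f0 E].
have [y [ty xy]] := h f f0; have [_ yx] := xy j (finset.in_setT j).
by move: ty; rewrite E leNgt -addA (addC u) addA lt_add2r yx.
Qed.

Lemma closed_lb (t : R) j : closed_set (fun x : V -> R => t <= x j).
Proof.
move=> x h; rewrite leNgt; apply/negP => /lt_subE[f f0 E].
have [y [ty xy]] := h f f0; have [_ yx] := xy j (finset.in_setT j).
by move: ty; rewrite E leNgt yx.
Qed.

Lemma closed_ub (t : R) j : closed_set (fun x : V -> R => x j <= t).
Proof.
move=> x h; rewrite leNgt; apply/negP => /lt_subE[f f0 E].
have [y [ty xy]] := h f f0; have [xy' _] := xy j (finset.in_setT j).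
by move: xy'; rewrite E lt_add2r ltNge ty.
Qed.

Lemma closed_itv c d j : closed_set (fun x : V -> R => c <= x j <= d).
Proof.
rewrite (_ : (fun x => _) = fun x : V -> R => c <= x j /\ x j <= d).
  by apply: closed_and; [exact: closed_lb|exact: closed_ub].
by apply/funext => x; apply/propext; split=> [/andP|[-> ->]].
Qed.

Lemma closed_all (T : Type) (A : T -> (V -> R) -> Prop) :
  (forall i, closed_set (A i)) -> closed_set (fun x => forall i, A i x).
Proof. by move=> cA x h i; apply: cA => e /h[y [Ay xy]]; exists y. Qed.

(** A closed set is the increasing union of its parts in the cubes [[-r, r]^V]; [zero <= x i + r]
    stands for [-r <= x i]. *)
Lemma Sig_closed F : Def F -> closed_set F -> Sig F.
Proof.
move=> dF cF.
pose A r x := F x /\ forall i, zero <= x i + r /\ x i <= r.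
apply: (@Sig_ext (fun x => exists r, A r x)).
  move=> x; split=> [[r []]//|Fx]; have [r h] := fin_ub x.
  have /choice[g gE] := fun i => sub_ex zero (x i).
  have [r' h'] := fin_ub g; exists (Order.max r r'); split=> // i; split.
    rewrite -(gE i) addC le_add2l le_max h' orbT //.
  by rewrite le_max h.
apply: Sig_union.
- by rewrite /A; def_auto.
- apply: chain_homo => r s x rs [Fx h]; split=> // i; have [h1 h2] := h i.
  by rewrite (le_trans h2 rs) (le_trans h1) // le_add2l.
- move=> r; apply: Sig_compact; first by rewrite /A; def_auto.
    apply: closed_and => //; apply: closed_all => i; apply: closed_and.
      exact: closed_lb_add.
    exact: closed_ub.
  have [p pr] := sub_ex zero r; exists p, r => x [_ h] i; have [h1 ->] := h i.
  by rewrite andbT -(le_add2r r) pr.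
Qed.

(** An open set is the union over [s] of the closed sets of points whose box of radius [s] lies in
    it, a chain decreasing in [s]. *)
Lemma Sig_open U : Def U -> open_set U -> Sig U.
Proof.
move=> dU oU.
pose A s x := zero < s /\ forall y, ball [set: V]%SET s x y -> U y.
apply: (@Sig_ext (fun x => exists s, A s x)).
  move=> x; split=> [[s [s0 h]]|/oU[s h]]; last by exists s.
  by apply: h; apply: ball_refl.
have dA : Def (fun p : R * (V -> R) => A p.1 p.2) by rewrite /A; def_auto.
apply: Sig_union => //.
  apply: chain_anti_pos => [s x []//|s t x s0 st [t0 h]]; split=> // y xy.
  by apply: h; apply: ball_le xy.
move=> s; apply: Sig_closed; first by def_auto.
move=> x h; have [e e0] := pos_ex; split; first by have [y [[]]] := h e e0.
move=> y /ballC/ball_open[f f0 hf]; have [z [[_ hz] xz]] := h f f0.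
by apply: hz; apply: ballC; apply: hf.
Qed.

Lemma open_compl A : closed_set A -> open_set (fun x => ~ A x).
Proof.
move=> cA x nAx; apply: contrapT => h; apply: nAx; apply: cA => e e0.
apply: contrapT => h'; apply: h; exists e; split=> // y xy Ay; apply: h'.
by exists y.
Qed.

Lemma open_ball I e x : open_set (ball I e x).
Proof.
move=> y /ball_open[f f0 hf]; exists f; split=> // z yz; apply: hf.
by apply: ball_sub yz; apply: finset.subsetT.
Qed.

(** The values of the bounded coordinate [j] found over smaller and smaller boxes around [x] form a
    chain; a value adherent to all of them lifts [x] to [F]. *)
Lemma closed_proj1 F j p q : Def F -> closed_set F ->
  (forall x, F x -> p <= x j <= q) -> closed_set (fun x => exists t, F (upd x j t)).
Proof.
move=> dF cF Fpq x h.
have bnd y t : F (upd y j t) -> p <= t <= q by move=> /Fpq; rewrite upd_same.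
pose W e t := exists y, ball [set: V]%SET e x y /\ F (upd y j t).
have [|||||w _ hw] := @chain_compact (fun e => zero < e) W p q.
- by def_auto.
- by rewrite /W; def_auto.
- exact: pos_ex.
- move=> e f _ _; case/orP: (le_total e f) => ef; [left|right] => t [y [xy Fy]];
    by exists y; split=> //; apply: ball_le xy.
- move=> e /h[y [[t Fy] xy]]; exists t; [by exists y|exact: (bnd y)].
exists w; apply: cF => e e0; have [u [y [xy Fy]] wu] := hw e e e0 e0.
exists (upd y j u); split=> //; rewrite -(finset.setUT [set j]%SET).
exact: ball_upd2.
Qed.

Lemma closed_proj_seq K (s : seq V) : Def K -> closed_set K -> bounded_set K ->
  closed_set (fun x => exists y, K y /\ forall i, i \notin s -> y i = x i).
Proof.
move=> dK cK [p [q Kpq]]; elim: s => [|j s IH].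
  by move=> x h; exists x; split=> //; apply: cK => e /h[y [[z [Kz zy]] xy]];
    exists y; split=> //; rewrite (_ : y = z) //; apply/funext => i; rewrite zy.
have [js|js] := boolP (j \in s).
  rewrite (_ : (fun x => _) = fun x => exists y, K y /\ forall i, i \notin s -> y i = x i)//.
  apply/funext => x; apply/propext; split=> -[y [Ky h]]; exists y; split=> // i hi; apply: h.
    by rewrite inE negb_or hi andbT; apply: contraNneq hi => ->.
  by move: hi; rewrite inE negb_or => /andP[].
pose F x := exists y, K y /\ forall i, i \notin s -> y i = x i.
have dF : Def F by rewrite /F; def_auto.
have Fpq x : F x -> p <= x j <= q by move=> [y [Ky h]]; rewrite -h //; apply: Kpq.
suff -> : (fun x => exists y, K y /\ forall i, i \notin j :: s -> y i = x i) =
    (fun x => exists t, F (upd x j t)) by exact: closed_proj1 dF IH Fpq.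
apply/funext => x; apply/propext; split=> [[y [Ky h]]|[t [y [Ky h]]]]; last first.
  exists y; split=> // i; rewrite inE negb_or => /andP[ij /h->].
  by rewrite upd_neq.
exists (y j), y; split=> // i si; rewrite /upd; case: eqP => [->//|/eqP ij].
by apply: h; rewrite inE negb_or ij.
Qed.

(** The projection of [A] to [R^I], pulled back to [R^V]. *)
Definition cyl I A x : Prop := exists y, A y /\ forall i, i \in I -> y i = x i.

Lemma cylin_cyl I A : cylin I (cyl I A).
Proof. by move=> x y xy [z [Az zx]]; exists z; split=> // i iI; rewrite zx ?xy. Qed.

Lemma closed_cyl I K : Def K -> closed_set K -> bounded_set K -> closed_set (cyl I K).
Proof.
move=> dK cK bK; have := @closed_proj_seq K (enum (~: I)%SET) dK cK bK.
rewrite (_ : (fun x => _) = cyl I K)//; apply/funext => x; apply/propext.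
by split=> -[y [Ky h]]; exists y; split=> // i iI; apply: h; move: iI;
  rewrite mem_enum inE negbK.
Qed.

(** Compact sets have closed projections. In a union, if no member has a projection with interior,
    all projections are nowhere dense and the Baire property applies. *)
Lemma Sig_cyl I A : baire I -> Sig A -> fat I (cyl I A) \/ nwd I (cyl I A).
Proof.
move=> bI; elim=> {A} [K dK cK bK|A dA chA sA IH].
  by apply: closed_fat_or_nwd; [exact: closed_cyl|exact: cylin_cyl].
have [[t [x [e [e0 h]]]]|nf] := pselect (exists t, fat I (cyl I (A t))).
  left; exists x, e; split=> // y /h[z [Az zy]]; exists z; split=> //.
  by exists t.
right; apply: (@nwd_sub _ _ _ (fun x => exists t, cyl I (A t) x)).
  by move=> x [y [[t Ay] yx]]; exists t, y.
apply: (bI (fun t => cyl I (A t))).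
- by rewrite /cyl; def_auto.
- by move=> s t; case: (chA s t) => h; [left|right] => x [y [/h Ay yx]]; exists y.
- by move=> t; apply: cylin_cyl.
by move=> t; case: (IH t) => // ft; case: nf; exists t.
Qed.

End SigmaSets.

(** * Definable Baire property *)

Section Stabilization.
Variable V : finType.
Implicit Types (x y z : V -> R) (I J : {set V}) (N k : nat).

Definition few_fibers I (A : (V -> R) -> Prop) N x0 e0 : Prop :=
  forall x, ball I e0 x0 x -> ~ at_least N (fun y => A y /\ forall i, i \in I -> y i = x i).

(** What makes frontiers small: where the fibres over [I] have bounded size, the set becomes
    relatively closed after shrinking the box. *)
Definition locally_compact_over I (A : (V -> R) -> Prop) : Prop :=
  forall N x0 e0, zero < e0 -> few_fibers I A N x0 e0 -> exists K x1 e1,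
  [/\ zero < e1, forall y, ball I e1 x1 y -> ball I e0 x0 y, Def K, closed_set K
    & forall y, ball I e1 x1 y -> (A y <-> K y)].

(* Otherwise, passing to smaller boxes, one finds members of the chain whose
   fibres have more and more points. *)
Lemma chain_stabilizes I (A : R -> (V -> R) -> Prop) N x0 e0 : baire I ->
  Def (fun p => A p.1 p.2) -> chain A -> (forall t, Sig (A t)) ->
  (forall t, locally_compact_over I (A t)) -> zero < e0 ->
  few_fibers I (fun y => exists t, A t y) N x0 e0 ->
  exists t x1 e1, [/\ zero < e1, forall y, ball I e1 x1 y -> ball I e0 x0 y &
    forall y, ball I e1 x1 y -> (exists s, A s y) -> A t y].
Proof.
move=> bI dA chA sA lA e00 few; apply: contrapT => H.
suff [t [x1 [e1 [e10 sub h]]]] : exists t x1 e1,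
    [/\ zero < e1, forall y, ball I e1 x1 y -> ball I e0 x0 y &
     forall x, ball I e1 x1 x ->
       at_least N (fun y => A t y /\ forall i, i \in I -> y i = x i)].
  have hx := ball_refl (I := I) x1 e10.
  apply: (few x1 (sub _ hx)); apply: at_least_sub (h _ hx) => y [Ay yx].
  by split=> //; exists t.
have: forall k, exists t x1 e1,
    [/\ zero < e1, forall y, ball I e1 x1 y -> ball I e0 x0 y &
     forall x, ball I e1 x1 x ->
       at_least k (fun y => A t y /\ forall i, i \in I -> y i = x i)]; last exact.
elim=> [|k [t [x1 [e1 [e10 sub h]]]]]; first by exists zero, x0, e0.
have fewt : few_fibers I (A t) N x1 e1.
  move=> x /sub/few nN h'; apply: nN; apply: at_least_sub h' => y [Ay yx].
  by split=> //; exists t.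
have [K [x2 [e2 [e20 sub2 dK cK AK]]]] := lA t N x1 e1 e10 fewt.
(* The points of [A s] outside [A t], written with [K]: the complement of [A t] is not yet known to
   be D-sigma, but that of a closed set is open. *)
pose B s y := A s y /\ (ball I e2 x2 y /\ ~ K y).
have sB s : Sig (B s).
  apply: Sig_and => //; apply: Sig_and; apply: Sig_open; try by def_auto.
    exact: open_ball.
  exact: open_compl.
have dB : Def (fun p : R * (V -> R) => B p.1 p.2) by rewrite /B; def_auto.
have chT : chain (fun s => cyl I (B s)).
  by move=> s u; case: (chA s u) => hs; [left|right] => x [y [[/hs Ay By] yx]];
    exists y.
have dT : Def (fun p : R * (V -> R) => cyl I (B p.1) p.2).
  by rewrite /cyl; def_auto.
(* Over a box avoiding these projections, [A t] is already the whole union. *)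
have [nT|nT] := pselect (nwd I (fun x => exists s, cyl I (B s) x)).
  have [x3 [e3 [e30 h3]]] := nwd_shrink x2 nT e20.
  exfalso; apply: H; exists t, x3, e3; split=> // [y /h3[/sub2/sub]//|y yb [s Asy]].
  have [y2 nTy] := h3 y yb; apply: contrapT => nA; apply: nTy; exists s, y.
  by split=> //; split=> //; split=> // /(AK _ y2).
(* Otherwise some [B s] projects onto a box, over which each fibre of [A s] has at least one point
   more than that of [A t]. *)
have [s nTs] : exists s, ~ nwd I (cyl I (B s)).
  apply: contrapT => h'; apply: nT; apply: (bI (fun s => cyl I (B s))) => //.
    by move=> s; apply: cylin_cyl.
  by move=> s; apply: contrapT => ?; apply: h'; exists s.
have [[x3 [e3 [e30 h3]]]|//] := Sig_cyl bI (sB s).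
have x23 : ball I e2 x2 x3.
  have [y [[_ [y2 _]] yx]] := h3 x3 (ball_refl _ e30).
  by apply: ball_eqr y2.
have [f f0 hf] := ball_open x23.
exists s, x3, (Order.min e3 f); rewrite lt_min e30 f0; split=> // [y yb|x xb].
  by apply/sub/sub2/hf; apply: ball_le yb; rewrite ge_min lexx orbT.
have /h3[y [[Asy [y2 nKy]] yx]] : ball I e3 x3 x.
  by apply: ball_le xb; rewrite ge_min lexx.
have nAty : ~ A t y by move=> /(AK _ y2).
have ts z : A t z -> A s z by case: (chA s t) => hs; [case: nAty; exact: hs|exact: hs].
apply: (at_least_ext (z := y)) (h x _); [by move=> z [/ts]|by []|by case|].
by apply: sub2; apply: hf; apply: ball_le xb; rewrite ge_min lexx orbT.
Qed.

(** Over a smaller box, a union with bounded fibres equals one of its members, to which the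
    induction hypothesis applies. *)
Lemma Sig_locally_compact I A : baire I -> Sig A -> locally_compact_over I A.
Proof.
move=> bI; elim=> {A} [K dK cK bK|A dA chA sA IH] N x0 e0 e00 few.
  by exists K, x0, e0.
have [t [x1 [e1 [e10 sub h]]]] := chain_stabilizes bI dA chA sA IH e00 few.
have [|K [x2 [e2 [e20 sub2 dK cK AK]]]] := IH t N x1 e1 e10.
  move=> x /sub/few nN h'; apply: nN; apply: at_least_sub h' => y [Ay yx].
  by split=> //; exists t.
exists K, x2, e2; split=> // [y /sub2/sub//|y yb]; rewrite -(AK y yb).
by split=> [|Ay]; [apply/h/sub2|exists t].
Qed.

(** Every ball over the empty set of coordinates is the whole space, so nowhere dense means
    empty. *)
Lemma baire_set0 : baire (finset.set0 : {set V}).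
Proof.
move=> A _ _ _ nA x e e0; exists x, e; split=> //; split; first exact: ball_refl.
move=> y _ [t Ay]; have [x' [f [f0 [_ h]]]] := nA t x e e0.
by apply: (h y) Ay => i; rewrite inE.
Qed.

(** If the union were dense in a box, the closures [B t] of the members in it would be nowhere
    dense, with nowhere dense fibres over generic points of [R^I]; by the result on the line, so
    would be the fibres of their union. These are then locally uniformly finite, the chain
    stabilizes over a smaller box, and a single [B t] contains a box. *)
Lemma baire_step I j : baire I -> j \notin I -> baire (j |: I).
Proof.
move=> bI jI A dA chA iA nA; apply: contrapT => /not_nwd[x0 [e0 [e00 dnsA]]].
pose B t x := forall e, zero < e ->
  exists y, A t y /\ ball (j |: I) e x y /\ ball (j |: I) e0 x0 y.
have dB : Def (fun p : R * (V -> R) => B p.1 p.2) by rewrite /B; def_auto.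
have chB : chain B.
  move=> s t; case: (chA s t) => h; [left|right] => x hx e /hx[y [/h]];
    by exists y.
have iB t : cylin (j |: I) (B t).
  move=> x y xy h e /h[z [Az [xz x0z]]]; exists z; split=> //; split=> //.
  by apply: ballC; apply: ball_eqr (ballC xz).
have cB t : closed_set (B t).
  move=> x h e e0'; have [f f0 fe] := half_ex e0'.
  have [y [By xy]] := h f f0; have [z [Az [yz x0z]]] := By f f0.
  exists z; split=> //; split=> //; apply: ball_le fe _; apply: ball_trans yz.
  by apply: ball_sub xy; apply: finset.subsetT.
have nB t : nwd (j |: I) (B t).
  move=> x e e_gt0; have [x' [f [f0 h]]] := nwd_shrink x (nA t) e_gt0.
  exists x', f; split=> //; split; first by case: (h x') => //; apply: ball_refl.
  move=> y /ball_open[g g0 hg] /(_ g g0)[z [Az [yz _]]].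
  by case: (h z) => //; apply: hg.
have AB t y : A t y -> ball (j |: I) e0 x0 y -> B t y.
  by move=> Ay x0y e e_gt0; exists y; split=> //; split=> //; apply: ball_refl.
have BL t x i e : i \in j |: I -> zero < e -> B t x -> near (e0 + e) (x0 i) (x i).
  move=> iI e_gt0 /(_ e e_gt0)[z [_ [xz x0z]]].
  by apply: (near_trans (x0z i iI)); apply: nearC; apply: xz.
have nP : nwd I (fun x => exists t, ~ nwd1 (fun w => B t (upd x j w))).
  have iP t : cylin I (fun x => ~ nwd1 (fun w => B t (upd x j w))).
    move=> x y xy nn h; apply: nn; apply: nwd1_sub h => w.
    by apply: iB; apply: upd_agree.
  apply: (bI (fun t x => ~ nwd1 (fun w => B t (upd x j w)))) => //.
  - by rewrite /nwd1; def_auto.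
  - move=> s t; case: (chB s t) => h; [left|right] => x nn h'; apply: nn;
      by apply: nwd1_sub h' => w /h.
  move=> t; have [l [u [lE uE lu]]] := nearE (e0 + e0) (x0 j).
  apply: (@fiber_nwd _ I j (B t) l u) => //; first by def_auto.
  move=> x /(BL _ _ j e0 (finset.setU11 _ _) e00)/lu[/ltW-> /ltW->] //.
have [x1 [e1 [e10 h1]]] := nwd_shrink x0 nP e00.
have fibB x : ball I e1 x1 x -> nwd1 (fun w => exists t, B t (upd x j w)).
  move=> x1x; apply: (@nwd1_chain (fun t w => B t (upd x j w))); first by def_auto.
    by move=> s t; case: (chB s t) => h; [left|right] => w /h.
  by move=> t; apply: contrapT => nn; apply: (h1 x x1x).2; exists t.
pose X x w := exists t, B t (upd x j w).
have dX : Def (fun p : (V -> R) * R => X p.1 p.2) by rewrite /X; def_auto.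
have [c [d [D [N [cx xd D0 few]]]]] := few_near S_LUF2 (x0 j) x1 dX.
(* Coordinates outside [j |: I] are frozen at those of [x1], which makes the sets compact and their
   fibres over [I] subsets of a line. *)
pose A' t x := B t x /\ (c <= x j <= d /\ forall i, i \notin j |: I -> x i = x1 i).
have cA' t : closed_set (A' t).
  apply: closed_and => //; apply: closed_and; first exact: closed_itv.
  apply: closed_all => i; apply: closed_all => _.
  move=> x h; have := @closed_itv V (x1 i) (x1 i) i x.
  case/(_ _)/andP => [e /h[y [yi xy]]|le1 le2]; first by exists y; rewrite yi lexx.
  by apply/le_anti; rewrite le1 le2.
have bA' t : bounded_set (A' t).
  have /choice[l hl] : forall i, exists l, forall x, A' t x -> l <= x i.
    move=> i; have [iI|iI] := boolP (i \in j |: I).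
      have [l [u [lE uE lu]]] := nearE (e0 + e0) (x0 i).
      by exists l => x [Bx _]; have /lu[/ltW] := BL t x i e0 iI e00 Bx.
    by exists (x1 i) => x [_ [_ /(_ i iI)->]].
  have /choice[u hu] : forall i, exists u, forall x, A' t x -> x i <= u.
    move=> i; have [iI|iI] := boolP (i \in j |: I).
      have [l' [u [lE uE lu]]] := nearE (e0 + e0) (x0 i).
      by exists u => x [Bx _]; have /lu[_ /ltW] := BL t x i e0 iI e00 Bx.
    by exists (x1 i) => x [_ [_ /(_ i iI)->]].
  have [p lp] := fin_lb l; have [q uq] := fin_ub u.
  by exists p, q => x Ax i; rewrite (le_trans (lp i) (hl i x Ax)) (le_trans (hu i x Ax)).
have dA' : Def (fun p : R * (V -> R) => A' p.1 p.2) by rewrite /A'; def_auto.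
have sA' t : Sig (A' t) by apply: Sig_compact => //; def_auto.
have chA' : chain A'.
  by move=> s t; case: (chB s t) => h; [left|right] => x [/h].
have kA' t : locally_compact_over I (A' t).
  move=> M y f f0 _; exists (A' t), y, f; split=> //; by def_auto.
pose g0 := Order.min D e1.
have g00 : zero < g0 by rewrite lt_min D0 e10.
have fewA' : few_fibers I (fun y => exists t, A' t y) N x1 g0.
  move=> x x1x.
  pose x' := mix I x x1.
  have x'D : ball [set: V]%SET D x1 x'.
    move=> i _; rewrite /x' /mix; case: ifP => iI; last exact: near_refl.
    by apply: near_le (x1x i iI); rewrite ge_min lexx.
  have x'e : ball I e1 x1 x'.
    move=> i iI; rewrite /x' mix_in //.
    by apply: near_le (x1x i iI); rewrite ge_min lexx orbT.
  have E y : (exists t, A' t y) /\ (forall i, i \in I -> y i = x i) -> y = upd x' j (y j).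
    move=> [[t [_ [_ yx1]]] yx]; apply/funext => i; rewrite /upd; case: eqP => [->//|/eqP ij].
    rewrite /x' /mix; case: ifP => iI; first exact: yx.
    by rewrite yx1 // !inE (negbTE ij) iI.
  move=> h; apply: (few x' x'D (fibB x' x'e)).
  apply: at_least_sub (at_least_map (g := fun y => y j) _ h); last first.
    by move=> y z /E-> /E->; rewrite !upd_same => ->.
  move=> w [y hy ->]; have Ey := E y hy; case: hy => -[t [By [cyd _]]] _.
  by split=> //; exists t; rewrite -Ey.
have [t [x2 [e2 [e20 sub stab]]]] := chain_stabilizes bI dA' chA' sA' kA' g00 fewA'.
apply: (fat_not_nwd (A := B t) (I := j |: I)) => //.
have [f1 f10 hf1] := near_itv cx xd.
exists (upd x2 j (x0 j)), (Order.min f1 (Order.min e0 e2)); rewrite !lt_min f10 e00 e20.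
split=> // z /ballU1[]; rewrite upd_same => zj zI.
have {}zI : ball I e2 x2 z.
  move=> i iI; have ij : i != j by apply: contraNneq jI => <-.
  by have := zI i iI; rewrite upd_neq //; apply: near_le; rewrite !ge_min lexx !orbT.
have [cz zd] : c < z j /\ z j < d.
  by apply: hf1; apply: near_le zj; rewrite ge_min lexx.
have z0 : ball (j |: I) e0 x0 z.
  apply/ballU1; split; first by apply: near_le zj; rewrite !ge_min lexx orbT.
  have /h1[] // : ball I e1 x1 z.
  by apply: ball_le (sub _ zI); rewrite ge_min lexx orbT.
apply: (closed_cylin (cB t) (iB t)) => e e_gt0.
have [r1 r10 hr1] := ball_open z0; have [r2 r20 hr2] := ball_open zI.
have [r3 r30 hr3] := near_itv cz zd.
have r0 : zero < Order.min (Order.min e r1) (Order.min r2 r3).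
  by rewrite !lt_min e_gt0 r10 r20.
have [y [[s Asy] zy]] := dnsA z _ r0 z0.
exists y; split; last by apply: ball_le zy; rewrite !ge_min lexx.
have x0y : ball (j |: I) e0 x0 y.
  by apply: hr1; apply: ball_le zy; rewrite !ge_min lexx orbT.
have x2y : ball I e2 x2 y.
  apply: hr2; apply: (@ball_le _ _ (Order.min (Order.min e r1) (Order.min r2 r3))).
    by rewrite !ge_min lexx !orbT.
  by apply: ball_sub zy; apply: finset.subsetUr.
have [cy yd] : c < y j /\ y j < d.
  apply: hr3; apply: near_le (zy j (finset.setU11 _ _)).
  by rewrite !ge_min lexx !orbT.
pose y' := mix (j |: I) y x1.
have y'E i : i \in j |: I -> y' i = y i by move=> iI; rewrite /y' mix_in.
have A'y' : A' s y'.
  split; first by apply: iB (AB s y Asy x0y) => i iI; rewrite y'E.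
  split; first by rewrite y'E ?finset.setU11 // !ltW.
  by move=> i iI; rewrite /y' mix_notin.
have [] := stab y' _ (ex_intro _ s A'y').
  by apply: ball_eqr x2y => i iI; rewrite y'E // inE iI orbT.
by move=> By' _; apply: iB By' => i iI; rewrite y'E.
Qed.

Lemma baire_all I : baire I.
Proof.
move: {2}#|I| (erefl #|I|) => n; elim: n I => [|n IH] I.
  by move/eqP; rewrite cards_eq0 => /eqP->; apply: baire_set0.
move=> In; have [j jI] : exists j, j \in I by apply/card_gt0P; rewrite In.
rewrite -(finset.setD1K jI); apply: baire_step; last by rewrite !inE eqxx.
by apply: IH; move: In; rewrite (cardsD1 j) jI => -[].
Qed.

End Stabilization.

(** * Complements of D-sigma sets *)

Section Cousin.
Variable V : finType.
Implicit Types (x y z : V -> R) (I J : {set V}) (A B : (V -> R) -> Prop).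

(** Repeated bisection would need sequences; instead [c] is found one coordinate at a time, as an
    infimum of upper ends. This is the compactness of boxes, in the manner of Cousin's lemma. *)
Lemma cousin (Phi : (V -> R) -> (V -> R) -> Prop) (p0 q0 : V -> R) :
  Def (fun w => Phi w.1 w.2) ->
  (forall p q p' q', (forall i, p' i <= p i) -> (forall i, q i <= q' i) ->
     Phi p q -> Phi p' q') ->
  (forall p q j m, Phi p q -> Phi p (upd q j m) \/ Phi (upd p j m) q) ->
  (forall p q i, Phi p q -> p i <= q i) -> Phi p0 q0 ->
  exists c, (forall i, p0 i <= c i <= q0 i) /\
    forall p q, (forall i, p i < c i /\ c i < q i) -> Phi p q.
Proof.
move=> dPhi mono split0 ne Phi0.
(* Boxes that surround [c] in the coordinates of [s] and keep the full range of the initial box in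
   the others. *)
pose C (s : seq V) c p q := (forall i, i \in s -> p i < c i /\ c i < q i) /\
  (forall i, i \notin s -> p i = p0 i /\ q i = q0 i).
suff [c [pcq h]] : exists c, (forall i, i \in enum V -> p0 i <= c i <= q0 i) /\
    forall p q, C (enum V) c p q -> Phi p q.
  exists c; split=> [i|p q pq]; first by apply: pcq; rewrite mem_enum.
  by apply: h; split=> i; rewrite mem_enum.
elim: (enum V) => [|j s [c [pcq h]]].
  exists p0; split=> // p q [_ pq].
  have -> : p = p0 by apply/funext => i; case: (pq i).
  by have -> : q = q0 by apply/funext => i; case: (pq i).
have [js|js] := boolP (j \in s).
  have E i : (i \in j :: s) = (i \in s) by rewrite inE; case: eqP => // ->.
  exists c; split=> [i|p q [h1 h2]]; first by rewrite E; apply: pcq.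
  by apply: h; split=> i; [move: (h1 i)|move: (h2 i)]; rewrite E.
(* Upper ends at which coordinate [j] can be cut off without losing [Phi]; their infimum is the new
   coordinate of [c]. *)
pose Psi m := m <= q0 j /\ forall p q, C s c p q -> Phi p (upd q j m).
have dPsi : Def Psi by rewrite /Psi /C; def_auto.
have Psi_q0 : Psi (q0 j).
  split=> // p q Cpq; have [_ /(_ j js)[_ <-]] := Cpq.
  by rewrite upd_id; apply: h.
have [p1 [q1 C1]] : exists p q, C s c p q.
  have /choice[l hl] := fun i => lt_ex (c i).
  have /choice[u hu] := fun i => gt_ex (c i).
  exists (fun i => if i \in s then l i else p0 i), (fun i => if i \in s then u i else q0 i).
  by split=> i; [move=> ->|move=> /negbTE->].
have Psi_lb m : Psi m -> p0 j <= m.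
  move=> [_ /(_ _ _ C1)/(ne _ _ j)]; rewrite upd_same.
  by have [_ /(_ j js)[-> _]] := C1.
have [m0 [lb gb]] := inf_ex dPsi (ex_intro _ _ Psi_q0) (ex_intro _ _ Psi_lb).
exists (upd c j m0); split.
  move=> i; rewrite inE /upd; case: eqP => [->|_] /=; last exact: pcq.
  by rewrite lb // andbT gb.
move=> p q [h1 h2]; have := h1 j; rewrite upd_same mem_head => -[] // pm mq.
have [m Psim mqj] : exists2 m, Psi m & m < q j.
  apply: contrapT => nm; have /gb : forall m, Psi m -> q j <= m.
    by move=> m Pm; rewrite leNgt; apply/negP => mq'; apply: nm; exists m.
  by rewrite leNgt mq.
(* Cutting off at [p j], below the infimum, loses [Phi] for some box. On its intersection [p3], [q3]
   with the given box, the lower part is therefore excluded and the upper part keeps [Phi]. *)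
have [p2 [q2 [C2 nPhi2]]] : exists p2 q2, C s c p2 q2 /\ ~ Phi p2 (upd q2 j (p j)).
  apply: contrapT => h3; have /lb : Psi (p j).
    split; first by apply/ltW/(lt_le_trans pm)/lb.
    by move=> p2 q2 C2; apply: contrapT => nP; apply: h3; exists p2, q2.
  by rewrite leNgt pm.
pose p3 := fun i => Order.max (upd p j (p0 j) i) (p2 i).
pose q3 := fun i => Order.min (upd q j (q0 j) i) (q2 i).
have C3 : C s c p3 q3.
  split=> i si; rewrite /p3 /q3.
    have ij : i != j by apply: contraNneq js => <-.
    have := h1 i; rewrite inE si orbT !upd_neq // gt_max lt_min => -[] // -> ->.
    by have [/(_ i si)[-> ->] _] := C2.
  have [_ /(_ i si)[-> ->]] := C2; rewrite /upd.
  case: eqP => [->|/eqP ij]; first by rewrite maxxx minxx.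
  by have [] := h2 i; rewrite ?inE ?negb_or ?ij // => -> ->; rewrite maxxx minxx.
have [_ /(_ _ _ C3) P3] := Psim; case: (split0 _ _ j (p j) P3) => h3.
  exfalso; apply: nPhi2; apply: mono h3 => i; first by rewrite le_max lexx orbT.
  by rewrite /upd; case: eqP => // _; rewrite ge_min lexx orbT.
apply: mono h3 => i; rewrite /upd; case: eqP => [->//|/eqP ij]; [|exact: ltW| ].
  by rewrite /p3 upd_neq // le_max lexx.
by rewrite /q3 upd_neq // ge_min lexx.
Qed.
End Cousin.

Section Complement.
Variable V : finType.
Implicit Types (x y z : V -> R) (I J : {set V}) (A B : (V -> R) -> Prop).

(** For a compact set this is [fiber_nwd]. For a union, the result on the line turns a bad fibre of
    the union into a bad fibre of a member, and the Baire property joins the exceptional sets of the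
    members. *)
Lemma Sig_fiber_nwd I j A : j \notin I -> Sig A -> nwd (j |: I) (cyl (j |: I) A) ->
  nwd I (fun x => ~ nwd1 (fun t => cyl (j |: I) A (upd x j t))).
Proof.
move=> jI; elim=> {A} [K dK cK [p [q Kpq]]|A dA chA sA IH] nA.
  apply: (@fiber_nwd _ I j (cyl (j |: I) K) p q) => //.
  - exact: baire_all.
  - by rewrite /cyl; def_auto.
  - by apply: closed_cyl => //; exists p, q.
  - exact: cylin_cyl.
  - by move=> x [y [Ky <-]]; [exact: Kpq|exact: finset.setU11].
have chC : chain (fun t => cyl (j |: I) (A t)).
  by move=> s t; case: (chA s t) => h; [left|right] => x [y [/h Ay yx]]; exists y.
have dC : Def (fun p : R * (V -> R) => cyl (j |: I) (A p.1) p.2).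
  by rewrite /cyl; def_auto.
pose P t x := ~ nwd1 (fun w => cyl (j |: I) (A t) (upd x j w)).
apply: (@nwd_sub _ _ _ (fun x => exists t, P t x)).
  move=> x nn; apply: contrapT => nP; apply: nn.
  apply: (@nwd1_sub _ (fun w => exists t, cyl (j |: I) (A t) (upd x j w))).
    by move=> w [y [[t Ay] yx]]; exists t, y.
  apply: (@nwd1_chain (fun t w => cyl (j |: I) (A t) (upd x j w))).
  - by rewrite /cyl; def_auto.
  - by move=> s t; case: (chC s t) => h; [left|right] => w /h.
  - by move=> t; apply: contrapT => h; apply: nP; exists t.
apply: (@baire_all V I P).
- rewrite /P /nwd1 /cyl; def_auto.
- by move=> s t; case: (chC s t) => h; [left|right] => x nn h'; apply: nn;
    apply: nwd1_sub h' => w /h.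
- move=> t x y xy nn h; apply: nn; apply: nwd1_sub h => w.
  by apply: cylin_cyl; apply: upd_agree.
move=> t; apply: IH; apply: nwd_sub nA => x [y [Ay yx]].
by exists y; split=> //; exists t.
Qed.

(** Dimension below [d]. For [d = 0] it means that [A] is empty, for [d > #|V|] it is vacuous: the
    two ends of the induction on [d]. *)
Definition dim_lt d A : Prop := forall I, #|I| = d -> nwd I (cyl I A).

Definition adherent A x : Prop :=
  forall e, zero < e -> exists y, A y /\ ball [set: V]%SET e x y.

(** The closure of the set of missing adherent points rather than that set itself, so that the
    frontier is closed and therefore D-sigma. *)
Definition frontier A : (V -> R) -> Prop :=
  adherent (fun x => adherent A x /\ ~ A x).

Lemma closed_adherent A : closed_set (adherent A).
Proof.
move=> x h e e0; have [f f0 fe] := half_ex e0.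
have [y [Ay xy]] := h f f0; have [z [Az yz]] := Ay f f0.
by exists z; split=> //; apply: ball_le fe _; apply: ball_trans xy yz.
Qed.

Lemma Def_frontier A : Def A -> Def (frontier A).
Proof. by move=> dA; rewrite /frontier /adherent; def_auto. Qed.

Definition in_box (p q x : V -> R) : Prop := forall i, p i <= x i <= q i.

Lemma Sig_box_restrict I A (p q : V -> R) : Sig A ->
  Sig (fun y => A y /\ forall i, i \notin I -> p i <= y i <= q i).
Proof.
move=> sA; apply: Sig_and => //; apply: Sig_closed; first by def_auto.
by apply: closed_all => i; apply: closed_all => _; apply: closed_itv.
Qed.

(** A point of a fibre is coded by the positions of its coordinates in lists shorter than [M], so
    the number of codes bounds the fibre. *)
Lemma few_fibers_box I A D c (lo hi : V -> R) (N : V -> nat) :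
  (forall j x, j \notin I -> ball I D c x ->
     ~ at_least (N j) (fun t => cyl (j |: I) A (upd (mix I x c) j t) /\ lo j <= t <= hi j)) ->
  exists M, few_fibers I (fun y => A y /\ forall i, i \notin I -> lo i <= y i <= hi i)
    M c D.
Proof.
move=> few; pose M := (\max_j N j).+1.
exists #|{: {ffun V -> 'I_M}}|.+1 => x cx h.
have /choice[s hs] : forall j, exists s : seq R, (size s < M)%N /\
    (j \notin I -> forall t, cyl (j |: I) A (upd (mix I x c) j t) ->
       lo j <= t <= hi j -> t \in s).
  move=> j; have [jI|jI] := boolP (j \in I); first by exists [::].
  have [s sN sE] := not_at_least_seq (few j x jI cx); exists s.
  split=> [|_ t At lt]; last by apply/sE.
  by rewrite (leq_trans sN) // ltnW // ltnS; apply: (leq_bigmax j).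
pose f (phi : {ffun V -> 'I_M}) i := if i \in I then x i else nth zero (s i) (phi i).
have := @at_least_card _ _ f _ _ _ h; rewrite ltnn => H; suff : false by []; apply: H.
move=> y [[Ay ylh] yx].
exists [ffun i => inord (index (y i) (s i))]; apply/funext => i; rewrite /f ffunE.
have [iI|iI] := boolP (i \in I); first exact: yx.
have ys : y i \in s i.
  apply: (hs i).2; [by []| |exact: ylh].
  exists y; split=> // k; rewrite /upd !inE; case: eqP => [->//|_] /= kI.
  by rewrite mix_in // yx.
have iM : (index (y i) (s i) < M)%N.
  by apply: leq_trans (hs i).1; rewrite ltnS index_size.
by rewrite inordK // nth_index.
Qed.

(** Off a nowhere dense set [P], the fibres of [A] over [R^I] have nowhere dense projections to each
    further coordinate, but bounds on them hold only near a point given in advance. If the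
    projection of the frontier were somewhere dense, [cousin] would supply a point [c] around which
    it stays so. Near [c] the fibres of [A] are bounded, so [A] is closed over a smaller box, which
    leaves no frontier there. *)
Lemma frontier_dim d A : Sig A -> dim_lt d.+1 A -> dim_lt d (frontier A).
Proof.
move=> sA dimA I Id; apply: contrapT => nB; set B := frontier A in nB *.
have dA := Sig_Def sA; have dB : Def B := Def_frontier dA.
have cB : closed_set B := @closed_adherent _.
pose P x := exists j, j \notin I /\ ~ nwd1 (fun t => cyl (j |: I) A (upd x j t)).
have nP : nwd I P.
  apply: nwd_fin => j; have [jI|jI] := boolP (j \in I).
    by move=> x e e0; exists x, e; split=> //; split; [exact: ball_refl|move=> y _ []].
  apply: (@nwd_sub _ _ _ (fun x => ~ nwd1 (fun t => cyl (j |: I) A (upd x j t)))).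
    by move=> x [].
  by apply: Sig_fiber_nwd => //; apply: dimA; rewrite cardsU1 jI Id.
have [x0 [e0 [e00 dnsB]]] := not_nwd nB.
have [x1 [e1 [e10 h1]]] := nwd_shrink x0 nP e00.
have [e2 e20 e21] := dense e10.
have /choice[l hl] := fun i => sub_ex (x1 i) e2.
pose Phi (p q : V -> R) := ~ nwd I (cyl I (fun y => B y /\ in_box p q y)).
have [p0 [q0 [Phi0 box0]]] : exists p q, Phi p q /\
    forall c, in_box p q c -> ball I e1 x1 c.
  (* Coordinates in [I] stay within [e2] of [x1], the others in [[-r, r]]; by the Baire property one
     [r] suffices. *)
  pose C r y := B y /\ ((forall i, i \in I -> l i <= y i <= x1 i + e2) /\
    (forall i, i \notin I -> zero <= y i + r /\ y i <= r)).
  have [r nC] : exists r, ~ nwd I (cyl I (C r)).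
    apply: contrapT => hn.
    apply: (@dense_not_nwd _ I (fun x => exists r, cyl I (C r) x) x1 e2) => //.
      move=> x f f0 x1x; have [g g0 hg] := ball_open x1x.
      have fg0 : zero < Order.min f g by rewrite lt_min f0.
      have [y [[z [Bz zy]] xy]] := dnsB x _ fg0 (h1 x (ball_le (ltW e21) x1x)).1.
      exists y; split; last by apply: ball_le xy; rewrite ge_min lexx.
      have [r hr] := fin_ub z.
      have /choice[u hu] := fun i => sub_ex zero (z i).
      have [r' hr'] := fin_ub u; exists (Order.max r r'), z; split=> //.
      split=> //; split=> i iI.
        have [] : near e2 (x1 i) (z i).
          by rewrite zy //; apply: hg => //; apply: ball_le xy; rewrite ge_min lexx orbT.
        by rewrite -{1}(hl i) lt_add2r => /ltW-> /ltW->.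
      by split; [rewrite -(hu i) addC le_add2l le_max hr' orbT|rewrite le_max hr].
    apply: (@baire_all V I (fun r => cyl I (C r))).
    - by rewrite /cyl /C; def_auto.
    - apply: chain_homo => r s x rs [y [[By [h2 h3]] yx]]; exists y; split=> //.
      split=> //; split=> // i /h3[h4 h5]; rewrite (le_trans h5) //.
      by rewrite (le_trans h4) // le_add2l.
    - by move=> r; apply: cylin_cyl.
    - by move=> r; apply: contrapT => nr; apply: hn; exists r.
  have [m mr] := sub_ex zero r.
  exists (fun i => if i \in I then l i else m), (fun i => if i \in I then x1 i + e2 else r).
  split.
    move=> h; apply: nC; apply: nwd_sub h => x [y [[By [h2 h3]] yx]]; exists y; split=> //.
    split=> // i; case: ifP => iI; first exact: h2.
    by have [|h4 ->] := h3 i; [rewrite iI|rewrite andbT -(le_add2r r) mr].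
  move=> c hc i iI; have := hc i; rewrite iI => /andP[lc cu]; split.
    by rewrite -(hl i); apply: (le_lt_trans (y := c i + e2)); rewrite ?le_add2r ?lt_add2l.
  by apply: (le_lt_trans cu); rewrite lt_add2l.
have dPhi : Def (fun w => Phi w.1 w.2).
  by rewrite /Phi /nwd /cyl /in_box; def_auto.
have [|||c [c0 hc]] := cousin dPhi _ _ _ Phi0.
- move=> p q p' q' pp qq nn h; apply: nn; apply: nwd_sub h => x [y [[By bx] yx]].
  exists y; split=> //; split=> // i; have /andP[h2 h3] := bx i.
  by rewrite (le_trans (pp i)) // (le_trans h3).
- move=> p q j m nn; apply: contrapT => /not_orP[/contrapT n1 /contrapT n2]; apply: nn.
  apply: nwd_sub (nwd_union n1 n2) => x [y [[By bx] yx]].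
  case: (leP (y j) m) => yjm; [left|right]; exists y; split=> //; split=> // i;
    rewrite /upd; case: eqP => [->|_] //; have /andP[h2 h3] := bx j.
    by rewrite h2.
  by rewrite h3 ltW.
- move=> p q i nn; rewrite leNgt; apply/negP => qp; apply: nn => x e e_gt0.
  exists x, e; split=> //; split; [exact: ball_refl|move=> y _ [z [[_ /(_ i)/andP[h2 h3]] _]]].
  by have := le_lt_trans (le_trans h2 h3) qp; rewrite ltxx.
have x1c : ball I e1 x1 c := box0 c c0.
pose X j x t := j \notin I /\ (ball I e1 x1 x /\ cyl (j |: I) A (upd x j t)).
have nX j x : nwd1 (X j x).
  have [[jI xb]|nx] := pselect (j \notin I /\ ball I e1 x1 x); last first.
    by move=> a b ab; exists a, b; split=> // t _ _ [jI [xb _]]; apply: nx.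
  apply: (@nwd1_sub _ (fun t => cyl (j |: I) A (upd x j t))); first by move=> t [_ []].
  by apply: contrapT => nn; apply: (h1 x xb).2; exists j.
have /choice[lo] : forall j, exists lo hi D N, [/\ lo < c j, c j < hi, zero < D &
    forall x, ball [set: V]%SET D c x -> ~ at_least N (fun t => X j x t /\ lo <= t <= hi)].
  move=> j; have [|a [b [D [N [h2 h3 h4 h5]]]]] := @few_near S_LUF2 V (X j) (c j) c.
    by rewrite /X /cyl; def_auto.
  by exists a, b, D, N; split=> // x hx; apply: h5.
case/choice=> hi /choice[D /choice[N fewX]].
have [D0 D00 hD0] : exists2 e, zero < e & forall j f, zero < f -> f <= e -> f <= D j.
  apply: (fin_eps (P := fun j f => f <= D j)) => j.
  by exists (D j) => //; case: (fewX j).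
have [g g0 hg] := ball_open x1c.
pose D1 := Order.min D0 g; have D10 : zero < D1 by rewrite lt_min D00.
have [M fewM] : exists M, few_fibers I
    (fun y => A y /\ forall i, i \notin I -> lo i <= y i <= hi i) M c D1.
  apply: (few_fibers_box (N := N)) => j x jI cx; have [_ _ _ few] := fewX j.
  have x'I : ball I e1 x1 (mix I x c).
    apply: hg => i iI; rewrite mix_in //; apply: near_le (cx i iI).
    by rewrite ge_min lexx orbT.
  move=> h; apply: (few (mix I x c)).
    move=> i _; apply: (near_le (hD0 j D1 D10 _)); first by rewrite ge_min lexx.
    by rewrite /mix; case: ifP => iI; [exact: cx|exact: near_refl].
  by apply: at_least_sub h => t [].
(* A box around [c] strictly inside the one where fibres are counted, so that points close to it
   still lie in the latter. *)
have /choice[p2 hp2] : forall i, exists p2, [/\ lo i < p2, p2 < c i & c i < p2 + D1].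
  move=> i; have [lc _ _ _] := fewX i; have [w wc] := sub_ex (c i) D1.
  have [|p2] := @dense (Order.max (lo i) w) (c i).
    by rewrite gt_max lc -wc lt_addr.
  by rewrite gt_max => /andP[h2 h3] h4; exists p2; rewrite -{2}wc lt_add2r.
have /choice[q2 hq2] : forall i, exists q2, [/\ q2 < hi i, c i < q2 & q2 < c i + D1].
  move=> i; have [_ ch _ _] := fewX i.
  have [|q2] := @dense (c i) (Order.min (hi i) (c i + D1)).
    by rewrite lt_min ch lt_addr.
  by rewrite lt_min => h2 /andP[h3 h4]; exists q2.
have /not_nwd[z0 [r0 [r00 dnsz]]] : Phi p2 q2.
  by apply: hc => i; have [_ ? _] := hp2 i; have [_ ? _] := hq2 i.
have boxD y : in_box p2 q2 y -> ball I D1 c y.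
  move=> hy i _; have /andP[h2 h3] := hy i; have [_ _ h4] := hp2 i; have [_ _ h5] := hq2 i.
  by split; [apply: (lt_le_trans h4); rewrite le_add2r|apply: le_lt_trans h5].
have [z1 [r1 [r10 [h01 hc1]]]] : exists z1 r1, zero < r1 /\
    (forall y, ball I r1 z1 y -> ball I r0 z0 y) /\
    forall y, ball I r1 z1 y -> ball I D1 c y.
  have [x [[y [[_ by2] yx]] z0x]] := dnsz z0 r0 r00 (ball_refl _ r00).
  have [a a0 ha] := ball_open z0x.
  have /ball_open[b b0 hb] : ball I D1 c x by apply: ball_eqr (boxD y by2).
  exists x, (Order.min a b); rewrite lt_min a0 b0; split=> //; split=> w xw.
    by apply: ha; apply: ball_le xw; rewrite ge_min lexx.
  by apply: hb; apply: ball_le xw; rewrite ge_min lexx orbT.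
have [K [z2 [r2 [r20 sub dK cK AK]]]] := Sig_locally_compact (@baire_all V I)
  (Sig_box_restrict I lo hi sA) r10 (fun x h => fewM x (hc1 x h)).
have [y [By bxy z2y]] : exists y, [/\ B y, in_box p2 q2 y & ball I r2 z2 y].
  have [x [[y [[By bxy] yx]] z2x]] := dnsz z2 r2 r20 (h01 _ (sub _ (ball_refl _ r20))).
  by exists y; split=> //; apply: ball_eqr z2x => i iI; rewrite yx.
have near_box x : in_box p2 q2 x -> exists2 e, zero < e &
    forall w, ball [set: V]%SET e x w -> forall i, lo i < w i /\ w i < hi i.
  move=> hx; have [i|e e_gt0 he] := @fin_eps V (fun i e => forall t, near e (x i) t ->
      lo i < t /\ t < hi i).
    have /andP[h2 h3] := hx i; have [h4 _ _] := hp2 i; have [h5 _ _] := hq2 i.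
    have [e e_gt0 he] := near_itv (lt_le_trans h4 h2) (le_lt_trans h3 h5).
    by exists e => // f f0 fe t /(near_le fe)/he.
  by exists e => // w xw i; apply: (he i e) => //; apply: xw; rewrite finset.in_setT.
have [e e_gt0 he] := near_box y bxy; have [e' e'0 he'] := ball_open z2y.
have ee0 : zero < Order.min e e' by rewrite lt_min e_gt0.
have [v [[Av nAv] yv]] := By _ ee0.
have z2v : ball I r2 z2 v.
  apply: he'; apply: (@ball_le _ _ (Order.min e e')); first by rewrite ge_min lexx orbT.
  by apply: ball_sub yv; apply: finset.subsetT.
have yv' : ball [set: V]%SET e y v by apply: ball_le yv; rewrite ge_min lexx.
(* [v] is adherent to [A], which near [v] agrees with the closed set [K]; so [v] is in [K] and hence
   in [A], though it was chosen outside. *)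
suff /(AK v z2v)[] : K v by [].
apply: cK => f f0; have [b b0 hb] := ball_open yv'; have [b' b'0 hb'] := ball_open z2v.
have ff0 : zero < Order.min f (Order.min b b') by rewrite !lt_min f0 b0.
have [w [Aw vw]] := Av _ ff0; exists w; split; last first.
  by apply: ball_le vw; rewrite ge_min lexx.
apply/AK.
  apply: hb'; apply: (@ball_le _ _ (Order.min f (Order.min b b'))).
    by rewrite !ge_min lexx !orbT.
  by apply: ball_sub vw; apply: finset.subsetT.
split=> // i _; have [|h2 h3] := he w _ i; last by rewrite !ltW.
by apply: hb; apply: ball_le vw; rewrite !ge_min lexx orbT.
Qed.

(** Off the frontier, a point outside [A] is not even adherent to [A], an open condition; on the
    frontier, only its intersection with [A] has to be removed, which has smaller dimension. *)
Lemma Sig_compl_dim d A : Sig A -> dim_lt d A -> Sig (fun x => ~ A x).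
Proof.
elim: d A => [|d IH] A sA dimA.
  apply: (@Sig_ext _ (fun=> True)) => [x|]; last by apply: Sig_closed => //; def_auto.
  split=> // _ Ax; have [e e0] := pos_ex.
  have [x' [f [f0 [_ h]]]] := dimA _ (cards0 _) x e e0.
  apply: (h x); first by move=> i; rewrite inE.
  by exists x; split.
have dimB := frontier_dim sA dimA; set B := frontier A in dimB.
have dA := Sig_Def sA; have dB : Def B := Def_frontier dA.
have cB : closed_set B := @closed_adherent _.
have sB : Sig B by apply: Sig_closed.
have sAB : Sig (fun x => ~ (A x /\ B x)).
  apply: IH; first exact: Sig_and.
  by move=> I /dimB; apply: nwd_sub => x [y [[_ By] yx]]; exists y.
have dcl : Def (adherent A) by rewrite /adherent; def_auto.
apply: (@Sig_ext _ (fun x => (~ B x /\ ~ adherent A x) \/ (B x /\ ~ (A x /\ B x)))).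
  move=> x; split=> [[[_ nAx] Ax|[Bx nAB] Ax]|nAx].
  - by apply: nAx => e e0; exists x; split=> //; apply: ball_refl.
  - exact: nAB.
  have [Bx|nBx] := pselect (B x); first by right; split=> // -[].
  left; split=> // clx; apply: nBx => e e0; exists x; split=> //.
  exact: ball_refl.
apply: Sig_or; last exact: Sig_and.
by apply: Sig_and; apply: Sig_open; try (by def_auto); apply: open_compl => //;
  apply: closed_adherent.
Qed.

Theorem Sig_compl A : Sig A -> Sig (fun x => ~ A x).
Proof.
move=> sA; apply: (@Sig_compl_dim #|V|.+1) => // I Icard.
by have := max_card (mem I); rewrite Icard ltnn.
Qed.

End Complement.

(** * Sets definable in the open core *)

Definition ocons (V : Type) (t : R) (x : V -> R) (o : option V) : R :=
  if o is Some v then x v else t.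

Lemma upd_ocons (V : eqType) t u (x : V -> R) : upd (ocons t x) None u = ocons u x.
Proof. by apply/funext => -[]. Qed.

Lemma Def_ocons (V : finType) (A : (option V -> R) -> Prop) : Def A ->
  Def (fun p : R * (V -> R) => A (ocons p.1 p.2)).
Proof.
move=> dA; refine (@Def_comp _ _ _ _ A (fun p => ocons p.1 p.2) dA _).
by apply: dmap_lam => -[v|] /=; dmap_auto.
Qed.

Lemma Sig_proj (V : finType) (A : (option V -> R) -> Prop) : Sig A ->
  Sig (fun x : V -> R => exists t, A (ocons t x)).
Proof.
elim=> {A} [K dK cK [p [q Kpq]]|A dA chA sA IH].
  have dK' := Def_ocons dK.
  pose B t x := K (ocons t x).
  have dB : Def (fun p => B p.1 p.2) by [].
  apply: Sig_compact; first by apply: (@Def_ex_pt _ _ (fun x t => B t x)); def_auto.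
    have cF := closed_proj1 dK cK (fun x Kx => Kpq x Kx None).
    move=> x h; have [|t] := cF (ocons zero x); last by rewrite upd_ocons; exists t.
    move=> e e0; have [y [[t Ky] xy]] := h e e0; exists (ocons zero y); split.
      by exists t; rewrite upd_ocons.
    move=> [v|] _ /=; [by apply: xy; rewrite finset.in_setT|exact: near_refl].
  by exists p, q => x [t /Kpq h] i; exact: (h (Some i)).
apply: (@Sig_ext _ (fun x => exists s t, A s (ocons t x))).
  by move=> x; split=> [[s [t h]]|[t [s h]]]; [exists t, s|exists s, t].
apply: Sig_union => //.
  have dg : dmap (fun p : R * (V -> R) * R => (p.1.1, ocons p.2 p.1.2)).
    apply: (@dmap_pair _ _ _ _ _ _ (fun p : R * (V -> R) * R => p.1.1)
      (fun p => ocons p.2 p.1.2)); first by dmap_auto.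
    by apply: dmap_lam => -[v|] /=; dmap_auto.
  apply: (@Def_ex_pt _ _ (fun p t => A p.1 (ocons t p.2))).
  exact: (Def_comp dA dg).
by move=> s t; case: (chA s t) => h; [left|right] => x [u /h]; exists u.
Qed.

Lemma dvar_near (V : finType) (s : (V -> R) -> R) e x y : dvar s -> zero < e ->
  ball [set: V]%SET e x y -> near e (s x) (s y).
Proof.
move=> [[c ->]|[v ->]] e0 xy; first exact: near_refl.
by apply: xy; rewrite finset.in_setT.
Qed.

Lemma closed_dvar_eq (V : finType) (s u : (V -> R) -> R) : dvar s -> dvar u ->
  closed_set (fun x => s x = u x).
Proof.
have le (a b : (V -> R) -> R) x : dvar a -> dvar b ->
    (forall e, zero < e -> exists y, a y = b y /\ ball [set: V]%SET e x y) -> a x <= b x.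
  move=> da db h; rewrite leNgt; apply/negP => /lt_subE[f f0 E].
  have [g g0 gf] := half_ex f0; have [y [ab xy]] := h g g0.
  have xa := dvar_near da g0 xy; have xb := dvar_near db g0 xy.
  rewrite ab in xa; have [] := near_trans xa (nearC xb).
  by rewrite E lt_add2l ltNge gf.
move=> ds du x h; apply/le_anti/andP; split; apply: le => // e /h[y [E xy]];
  by exists y.
Qed.

Lemma dvar_dmap G (cG : ctx G) (s : G -> R) : dvar s -> dmap s.
Proof. by move=> ds t [[c ->]|->//]; left; exists c. Qed.

(** The language of the open core has no function symbols. *)
Lemma open_core_term (t : term (open_core_language S)) : exists i, t = TVar i.
Proof. by case: t => [i|n []]; exists i. Qed.

Lemma rV_nbhs n (U : set 'rV[R]_n) v : open U -> U v -> exists2 e, zero < e &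
  forall w : 'rV[R]_n, (forall i, near e (v ord0 i) (w ord0 i)) -> U w.
Proof.
move=> oU Uv.
have [P vP PU] : nbhs v U by apply: open_nbhs_nbhs; split.
have [i|e e0 he] := @fin_eps 'I_n (fun i e => forall t, near e (v ord0 i) t -> P ord0 i t).
  have [c [d [cv vd h]]] := nbhs_itv (vP ord0 i).
  have [e e0 he] := near_itv cv vd; exists e => // f f0 fe t /(near_le fe)/he[ct td].
  by apply: h; rewrite !ltW.
exists e => // w vw; apply: PU => i j; rewrite (ord1 i).
exact: (he j e).
Qed.

Lemma Sig_sat (phi : formula (open_core_language S)) (V : finType)
    (s : nat -> (V -> R) -> R) : (forall i, dvar (s i)) ->
  Sig (fun x => sat (open_core S) (fun i => s i x) phi).
Proof.
elim: phi V s => [t u|n r ts|psi IH|psi IH1 chi IH2|psi IH] V s ds /=.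
- have [i ->] := open_core_term t; have [j ->] := open_core_term u.
  apply: Sig_closed; last exact: (@closed_dvar_eq V (s i) (s j)).
  by apply: (@Def_eq _ _ (s i) (s j)); apply: dterm_var; apply: dvar_dmap.
- have /choice[f fE] := fun i => open_core_term (ts i).
  rewrite (_ : (fun x => _) = fun x => sval r (\row_i s (f i) x)%R); last first.
    apply/funext => x; congr (sval r _); apply/rowP => i.
    by rewrite !mxE fE.
  case: r => U [n0 oU dU] /=; apply: Sig_open.
    refine (@Def_comp _ _ _ _ _ (fun x i => s (f i) x) (definable_Def dU) _).
    by apply: dmap_lam => i; apply: dvar_dmap.
  move=> x Ux; have [e e0 he] := rV_nbhs oU Ux; exists e; split=> // y xy.
  by apply: he => i; rewrite !mxE; apply: dvar_near.
- by apply: Sig_compl; apply: IH.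
- by apply: Sig_and; [apply: IH1|apply: IH2].
(* The bound variable reads the new coordinate [None]. *)
pose s' i (z : option V -> R) := if i is j.+1 then s j (z \o Some) else z None.
have ds' i : dvar (s' i).
  case: i => [|i] /=; first by right; exists None.
  by case: (ds i) => [[c E]|[v E]]; [left; exists c|right; exists (Some v)];
    apply/funext => z; rewrite /s' E.
apply: Sig_ext (Sig_proj (IH _ s' ds')) => x.
have E t : (fun i => s' i (ocons t x)) = push t (fun i => s i x).
  by apply/funext => -[|i].
by split=> -[t h]; exists t; rewrite ?E // -?E.
Qed.

Lemma open_core_Sig n (X : set 'rV[R]_n) (V : finType) (g : 'I_n -> (V -> R) -> R) :
  definable (open_core S) X -> (forall i, dvar (g i)) ->
  Sig (fun x => X (\row_i g i x)%R).
Proof.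
move=> [phi [e ->]] dg.
pose s i := if insub i is Some j then g j else fun=> e (i - n)%N.
apply: Sig_ext (Sig_sat phi (s := s) _).
  move=> x /=; set e1 := fun i : nat => _; set e2 := assign _ _.
  suff -> : e1 = e2 by [].
  apply/funext => i; rewrite /e1 /e2 /s /assign; case: insub => // j.
  by rewrite mxE.
by move=> i; rewrite /s; case: insub => [j|]; [exact: dg|left; exists (e (i - n)%N)].
Qed.

(** * Boundaries and local o-minimality *)

Definition boundary (A : R -> Prop) (t : R) : Prop := forall e, zero < e ->
  (exists u, A u /\ near e t u) /\ exists u, ~ A u /\ near e t u.

(** A D-sigma set meets an interval in a set with interior or in a nowhere dense one; so some
    subinterval lies in [A] or misses it, and contains no boundary point. *)
Lemma boundary_nwd1 (A : R -> Prop) : Sig (fun z : 'I_1 -> R => A (z ord0)) ->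
  nwd1 (boundary A).
Proof.
move=> sA; apply: contrapT => /not_nwd1[c [d [cd dns]]].
have bd_in w e : c <= w -> w <= d -> zero < e -> exists t f, [/\ zero < f, boundary A t,
    forall u, near f t u -> near e w u & forall u, near f t u -> c < u < d].
  move=> cw wd e0; have [c' [d' [h1 h2 h3 h4]]] := near_interval_meet e0 cd cw wd.
  have [t [bt ct td]] := dns c' d' h1 h2 h3.
  have [f f0 hf] := near_itv ct td; exists t, f; split=> // u /hf[cu ud]; first exact: h4.
  by rewrite (le_lt_trans h1 cu) (lt_le_trans ud h3).
pose G (z : 'I_1 -> R) := A (z ord0) /\ c < z ord0 < d.
have sG : Sig G.
  apply: Sig_and => //; apply: Sig_open; first by def_auto.
  move=> z /andP[cz zd]; have [e e0 he] := near_itv cz zd; exists e; split=> // y zy.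
  by have [|-> ->] := he (y ord0); first by apply: zy; rewrite finset.in_setT.
have GE z : cyl [set: 'I_1]%SET G z -> G z.
  move=> [y [Gy yz]]; rewrite (_ : z = y) //; apply/funext => i.
  by rewrite yz ?finset.in_setT.
have ball1 e (z y : 'I_1 -> R) : near e (z ord0) (y ord0) -> ball [set: 'I_1]%SET e z y.
  by move=> h i _; rewrite (ord1 i).
have [[z [e [e0 h]]]|nG] := Sig_cyl (@baire_all _ [set: 'I_1]%SET) sG.
  have [_ /andP[cz zd]] := GE z (h z (ball_refl _ e0)).
  have [t [f [f0 bt hf _]]] := bd_in _ e (ltW cz) (ltW zd) e0.
  have [_ [u [nAu tu]]] := bt f f0; apply: nAu.
  by have [] := GE (fun=> u) (h (fun=> u) (ball1 e z (fun=> u) (hf u tu))).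
have [m cm md] := dense cd; have [e e0 he] := near_itv cm md.
have [z [e' [e'0 [mz h]]]] := nG (fun=> m) e e0.
have /he[cz zd] : near e m (z ord0) by apply: mz; rewrite finset.in_setT.
have [t [f [f0 bt hf hcd]]] := bd_in _ e' (ltW cz) (ltW zd) e'0.
have [[u [Au tu]] _] := bt f f0.
apply: (h (fun=> u) (ball1 e' z (fun=> u) (hf u tu))); exists (fun=> u); split=> //.
by split=> //; apply: hcd.
Qed.

(** Definable connectedness of [[x, u]]: the boundary point is the supremum of the [z] with [[x, z]]
    contained in [A]. *)
Lemma boundary_between (A : R -> Prop) x u : Def A -> A x -> ~ A u -> x < u ->
  exists t, [/\ boundary A t, x <= t & t <= u].
Proof.
move=> dA Ax nAu xu.
pose E z := x <= z /\ z <= u /\ forall w, x <= w -> w <= z -> A w.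
have dE : Def E by rewrite /E; def_auto.
have Ex : E x.
  split=> //; split; first exact: ltW.
  by move=> w xw wx; rewrite (_ : w = x) //; apply/le_anti/andP.
have [t [ub lb]] := sup_ex dE (ex_intro _ x Ex) (ex_intro _ u (fun z (Ez : E z) => Ez.2.1)).
have tu : t <= u by apply: lb => z [_ []].
have xt : x <= t by apply: ub.
have above w : w < t -> exists2 z, E z & w < z.
  move=> wt; apply: contrapT => nz; have /lb : forall z, E z -> z <= w.
    by move=> z Ez; rewrite leNgt; apply/negP => wz; apply: nz; exists z.
  by rewrite leNgt wt.
exists t; split=> // e e0; split.
  have [c ce] := sub_ex t e.
  have [|z Ez cz] := above c; first by rewrite -ce lt_addr.
  exists z; split; first by case: Ez => xz [_]; apply.
  split; first by rewrite -ce lt_add2r.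
  by apply: (le_lt_trans (ub z Ez)); rewrite lt_addr.
apply: contrapT => h.
have Anear w : near e t w -> A w by move=> tw; apply: contrapT => nAw; apply: h; exists w.
have teu : t + e <= u.
  rewrite leNgt; apply/negP => ute; apply: nAu; apply: Anear; split=> //.
  by apply: (le_lt_trans tu); rewrite lt_addr.
have [f f0 fe] := dense e0.
have : E (t + f).
  split; first by apply: (le_trans xt); rewrite le_addr ltW.
  split; first by apply: le_trans teu; rewrite le_add2l ltW.
  move=> w xw wtf; case: (ltP w t) => [/above[z [_ [_ Az]] wz]|tw].
    by apply: Az => //; apply: ltW.
  apply: Anear; split; first by apply: (le_lt_trans tw); rewrite lt_addr.
  by apply: (le_lt_trans wtf); rewrite lt_add2l.
by move/ub; rewrite leNgt lt_addr f0.
Qed.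

Lemma boundary_not (A : R -> Prop) t : boundary (fun u => ~ A u) t -> boundary A t.
Proof.
move=> h e /h[[u [nAu tu]] [w [nnAw tw]]]; split; [exists w|by exists u].
by split=> //; apply: contrapT.
Qed.

Lemma seq_max_below (r : seq R) x c : c \in r -> c < x ->
  exists p, [/\ p \in r, p < x & forall t, t \in r -> t < x -> t <= p].
Proof.
elim: r c => [//|a r IH] c cr cx.
have [[c' c'r c'x]|nc] := pselect (exists2 c', c' \in r & c' < x); last first.
  move: cr; rewrite inE => /predU1P[ca|cr]; last by case: nc; exists c.
  exists a; rewrite mem_head -ca; split=> // t; rewrite inE ca => /predU1P[->//|tr tx].
  by case: nc; exists t.
have [p [pr px hp]] := IH c' c'r c'x.
have [ax|xa] := ltP a x; last first.
  exists p; rewrite inE pr orbT; split=> // t; rewrite inE => /predU1P[->|]; last exact: hp.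
  by rewrite ltNge xa.
exists (Order.max a p); split.
- by case: leP; rewrite inE ?eqxx ?pr ?orbT.
- by rewrite gt_max ax px.
- move=> t; rewrite inE => /predU1P[-> _|tr tx]; first by rewrite le_max lexx.
  by rewrite le_max (hp t tr tx) orbT.
Qed.

Lemma seq_min_above (r : seq R) x c : c \in r -> x < c ->
  exists p, [/\ p \in r, x < p & forall t, t \in r -> x < t -> p <= t].
Proof.
elim: r c => [//|a r IH] c cr xc.
have [[c' c'r xc']|nc] := pselect (exists2 c', c' \in r & x < c'); last first.
  move: cr; rewrite inE => /predU1P[ca|cr]; last by case: nc; exists c.
  exists a; rewrite mem_head -ca; split=> // t; rewrite inE ca => /predU1P[->//|tr tx].
  by case: nc; exists t.
have [p [pr px hp]] := IH c' c'r xc'.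
have [xa|ax] := ltP x a; last first.
  exists p; rewrite inE pr orbT; split=> // t; rewrite inE => /predU1P[->|]; last exact: hp.
  by rewrite ltNge ax.
exists (Order.min a p); split.
- by case: leP; rewrite inE ?eqxx ?pr ?orbT.
- by rewrite lt_min xa px.
- move=> t; rewrite inE => /predU1P[-> _|tr tx]; first by rewrite ge_min lexx.
  by rewrite ge_min (hp t tr tx) orbT.
Qed.

(** The intervals may overlap or be empty, so [l] simply collects all pairs of end points whose
    interval lies in the set. A point off the boundary lies between consecutive end points, where
    membership is constant. *)
Lemma finite_boundary_union (A : set R) c d N : Def (A : R -> Prop) -> c < d ->
  ~ at_least N (fun t => boundary A t /\ c <= t <= d) ->
  finite_union_points_intervals (A `&` `]c, d[%classic).
Proof.
move=> dA cd /not_at_least_seq[s _ sE].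
pose ends := c :: d :: s.
have [pts ptsE] : exists pts : seq R, forall t, t \in pts <-> t \in s /\ A t /\ c < t < d.
  exists [seq t <- s | `[< A t /\ c < t < d >]] => t; rewrite mem_filter.
  by split=> [/andP[/asboolP]|[-> /asboolP->]].
have [l lE] : exists l : seq (R * R), forall w, w \in l <->
    (w.1 \in ends /\ w.2 \in ends) /\ forall u, w.1 < u -> u < w.2 -> A u /\ c < u < d.
  exists [seq w <- [seq (p, q) | p <- ends, q <- ends] |
    `[< forall u, w.1 < u -> u < w.2 -> A u /\ c < u < d >]] => -[p q].
  rewrite mem_filter; split=> [/andP[/asboolP h /allpairsP[w [h1 h2 E]]]|].
    by case: E h => -> ->.
  move=> [[h1 h2] h]; apply/andP; split; first exact/asboolP.
  exact: (allpairs_f (fun p q : R => (p, q))).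
exists pts, l; apply/seteqP; split=> x; last first.
  move=> [/ptsE[_ [Ax cxd]]|[w /lE[_ h]]]; first by split=> //; rewrite /= in_itv.
  by rewrite /= in_itv /= => /andP[h1 h2]; have [Ax cxd] := h x h1 h2; split;
    rewrite //= in_itv.
move=> [Ax]; rewrite /= in_itv /= => /andP[cx xd].
have [xs|xs] := boolP (x \in s).
  by left; apply/ptsE; rewrite cx xd.
right.
have [p [pe px hp]] := seq_max_below (mem_head c (d :: s)) cx.
have de : d \in ends by rewrite !inE eqxx orbT.
have [q [qe xq hq]] := seq_min_above de xd.
exists (p, q); last by rewrite /= in_itv /= px.
apply/lE; split=> //.
have cp : c <= p by apply: hp => //; rewrite mem_head.
have qd : q <= d by apply: hq.
have nb t : p < t -> t < q -> ~ boundary A t.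
  move=> pt tq bt.
  have ts : t \in s by apply/sE; rewrite (le_trans cp) ?(le_trans (ltW tq)) // ltW.
  have te : t \in ends by rewrite !inE ts !orbT.
  case: (ltgtP t x) => [tx|xt|tx]; last by rewrite tx (negbTE xs) in ts.
    by have := hp t te tx; rewrite leNgt pt.
  by have := hq t te xt; rewrite leNgt tq.
move=> u /= pu uq; split; last first.
  by rewrite (le_lt_trans cp pu) (lt_le_trans uq qd).
apply: contrapT => nAu; case: (ltgtP u x) => [ux|xu|E]; last by apply: nAu; rewrite E.
  have dnA : Def (fun u => ~ A u) by apply: Def_not.
  have [t [/boundary_not bt ut tx]] := boundary_between dnA nAu (fun h => h Ax) ux.
  by apply: (nb t) => //; [apply: lt_le_trans ut|apply: le_lt_trans xq].
have [t [bt xt tu]] := boundary_between dA Ax nAu xu.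
by apply: (nb t) => //; [apply: lt_le_trans xt|apply: le_lt_trans uq].
Qed.

Lemma boundary_family n (X : set 'rV[R]_(n + 1)) :
  definable (open_core S) X ->
  let F (y : 'I_n -> R) t := boundary (slice X (\row_i y i)%R) t in
  [/\ Def (fun p => F p.1 p.2), forall y, nwd1 (F y) &
      forall y, Def (slice X (\row_i y i)%R : R -> Prop)].
Proof.
move=> dX F.
pose g (y : 'I_n -> R) (t : R) (i : 'I_(n + 1)) :=
  match fintype.split i with inl j => y j | inr _ => t end.
have sliceE y t : slice X (\row_i y i)%R t = X (\row_i g y t i)%R.
  rewrite /slice /=; congr X; apply/rowP => i; rewrite !mxE /g.
  by case: fintype.split => j; rewrite mxE.
have sX : Sig (fun x : 'I_(n + 1) -> R => X (\row_i x i)%R).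
  by apply: (open_core_Sig (g := fun i x => x i)) => // i; right; exists i.
have dsl : Def (fun p : ('I_n -> R) * R => slice X (\row_i p.1 i)%R p.2).
  apply: Def_ext (fun p => X (\row_i g p.1 p.2 i)%R) _ _ _.
    by move=> p; rewrite sliceE.
  refine (@Def_comp _ _ _ _ _ (fun p => g p.1 p.2) (Sig_Def sX) _).
  by apply: dmap_lam => i; rewrite /g; case: fintype.split => j; dmap_auto.
split=> [|y|y].
- pose A (y : 'I_n -> R) (t : R) := slice X (\row_i y i)%R t.
  have dA : Def (fun p => A p.1 p.2) := dsl.
  have: Def (fun p => boundary (A p.1) p.2) by rewrite /boundary; def_auto.
  by [].
- apply: boundary_nwd1.
  apply: Sig_ext (open_core_Sig (V := 'I_1) (g := fun i z => g y (z ord0) i) dX _).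
    by move=> z; rewrite sliceE.
  move=> i; rewrite /g; case: fintype.split => j; first by left; exists (y j).
  by right; exists ord0.
by refine (@Def_comp _ _ _ _ _ (fun t => (y, t)) dsl _); dmap_auto.
Qed.

Lemma rowE n (v : 'rV[R]_n) : v = (\row_i v ord0 i)%R.
Proof. by apply/rowP => i; rewrite mxE. Qed.

Lemma open_core_strong : SLUF S -> strongly_locally_o_minimal (open_core S).
Proof.
move=> HS a; have [c [e [ca ae H]]] := few_on_itv HS a.
exists `]c, e[%classic; split; [by exists c, e|by rewrite /= in_itv /= ca|move=> X dX].
have sX : Sig (fun x : 'I_1 -> R => X (x ord0)).
  apply: Sig_ext (open_core_Sig (g := fun i x => x i) dX _).
    by move=> x; rewrite /= mxE.
  by move=> i; right; exists i.
have dX' : Def (X : R -> Prop).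
  by refine (@Def_comp _ _ _ _ _ (fun t _ => t) (Sig_Def sX) _); dmap_auto.
(* A constant family with a dummy parameter. *)
have [||N few] := H 'I_1 (fun _ => boundary X).
- by rewrite /boundary; def_auto.
- by move=> _; apply: boundary_nwd1.
by apply: finite_boundary_union (few (fun=> zero)) => //; apply: lt_trans ae.
Qed.

Lemma open_core_uniform1 : LUF1 S -> uniformly_locally_o_minimal_1 (open_core S).
Proof.
move=> H1 n _ X dX a; have [dF nF dsl] := boundary_family dX.
have [c [e [N [ca ae few]]]] := few_near_all H1 a dF nF.
exists `]c, e[%classic; split; [by exists c, e|by rewrite /= in_itv /= ca|move=> y].
rewrite (rowE y).
by apply: finite_boundary_union (few (fun i => y ord0 i)) => //; apply: lt_trans ae.
Qed.

Lemma open_core_uniform2 : uniformly_locally_o_minimal_2 (open_core S).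
Proof.
move=> n _ X dX a b; have [dF nF dsl] := boundary_family dX.
have [c [e [D [N [ca ae D0 few]]]]] := few_near S_LUF2 a (fun i => b ord0 i)
  (X := fun y => boundary (slice X (\row_i y i)%R)) dF.
have /choice[l lE] : forall i, exists l, forall t,
    near D (b ord0 i) t <-> l < t /\ t < b ord0 i + D.
  by move=> i; have [l [u [_ -> h]]] := nearE D (b ord0 i); exists l.
exists `]c, e[%classic, [set v : 'rV[R]_n | forall i, l i < v ord0 i < b ord0 i + D]%classic.
split; [by exists c, e|by rewrite /= in_itv /= ca| | |move=> y hy].
- exists (\row_i l i)%R, (\row_i (b ord0 i + D)%O)%R; apply/seteqP.
  by split=> v /= h i; have := h i; rewrite !mxE.
- by move=> i; have /lE[-> ->] := near_refl (b ord0 i) D0.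
rewrite (rowE y).
apply: finite_boundary_union (few (fun i => y ord0 i) _ _) => //; first exact: lt_trans ae.
by move=> i _; apply/lE/andP; apply: hy.
Qed.

End SecondKind.

End DefinablyComplete.

Theorem theorem1p1 (d : Order.disp_t) (R : orderTopologicalType d)
    (add : R -> R -> R) (zero : R)
    (R_group : densely_ordered_group add zero)
    (L : language) (S : structure L R)
    (S_expands : expands_ordered_group add zero S)
    (S_complete : definably_complete S) :
  [/\ SLUF S -> strongly_locally_o_minimal (open_core S),
      LUF1 S -> uniformly_locally_o_minimal_1 (open_core S) &
      LUF2 S -> uniformly_locally_o_minimal_2 (open_core S)].
Proof.
split=> H.
- exact: (open_core_strong R_group S_expands S_complete H.1.1 H).
- exact: (open_core_uniform1 R_group S_expands S_complete H.1 H).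
- exact: (open_core_uniform2 R_group S_expands S_complete H).
Qed.
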